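(* Let $\lambda$ be a partition, $n\ge1$, $x_1,\dots,x_n>0$, $t\ge0$. Consider the tableau Markov chain on $\operatorname{Tab}(\lambda,n)$: from state $\sigma$, for each cell $u\in\operatorname{dg}(\lambda)$ with $\sigma(\mathrm S(u))\ne\sigma(u)$, there is a transition to $R'_u(\sigma)$ at rate $x_{\sigma(u)}^{-1}t^{\operatorname{down}(\sigma,u)}$ (with $0^0=1$), these rates adding when several cells lead to the same state. Then the probability measure on $\operatorname{Tab}(\lambda,n)$ proportional to $\operatorname{wt}(\sigma)=t^{\operatorname{quinv}(\sigma)}\prod_{u\in\operatorname{dg}(\lambda)}x_{\sigma(u)}$ is stationary for this chain.
   Context: Fillings: $\operatorname{dg}(\lambda)=\{(r,i):1\le i\le\ell(\lambda),\ 1\le r\le\lambda_i\}$ (row $r$ from the bottom, column $i$ from the left); $\operatorname{Tab}(\lambda,n)$ = set of maps $\sigma:\operatorname{dg}(\lambda)\to[n]$. $\mathcal Q$ = set of integer triples $(a,b,c)$ with $a<b<c$, or $b<c<a$, or $c<b<a$, or $a=b\ne c$. With $\sigma(\lambda_i+1,i):=0$, $\operatorname{quinv}(\sigma)$ = number of pairs of cells $(r,i),(r,j)$, $i<j$, with $(\sigma(r+1,i),\sigma(r,i),\sigma(r,j))\in\mathcal Q$. Statistics: for $u=(r,c)$, $\mathrm S(u)=(r-1,c)$, $\mathrm N(u)=(r+1,c)$, with $\sigma(\mathrm S(u))=\infty$ if $r=1$ and $\sigma(\mathrm N(u))=0$ if $r=\lambda_c$. $\operatorname{arm}(u)=\{(r,j)\in\operatorname{dg}(\lambda):j<c\}\cup\{(r-1,j)\in\operatorname{dg}(\lambda):j>c\}$.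 $\operatorname{down}(\sigma,u)=\#\{y\in\operatorname{arm}(u):\sigma(y)=\sigma(u)\}$ when $\sigma(\mathrm S(u))\ne\sigma(u)$. Ringing path map: $h_u(\sigma)$ is the largest $h$ with $r\le h\le\lambda_c$ such that $\sigma(i+1,c)-\sigma(i,c)\equiv1\pmod n$ for all $r\le i<h$. If $\sigma(\mathrm S(u))\neq\sigma(u)$, $R_u(\sigma)$ increments (cyclically, $n\mapsto1$) the entries of cells $(i,c)$, $r\le i\le h_u(\sigma)$, other entries unchanged. Operators $\tau_j$: if $\lambda_j=\lambda_{j+1}=h$, write $a_i=\sigma(i,j)$, $b_i=\sigma(i,j+1)$. Let $r_{\max}$ be the largest $r\in\{2,\dots,h\}$ such that $(a_r,a_{r-1},b_{r-1})\in\mathcal Q\iff(b_r,a_{r-1},b_{r-1})\in\mathcal Q$, or $r_{\max}=1$ if none. $\tau_j(\sigma)$ swaps the entries of $(i,j)$ and $(i,j+1)$ for all $r_{\max}\le i\le h$. Map $R'_u$: for $\xi$ and $u=(r',v)$ with $\xi(\mathrm S(u))\ne\xi(u)$, let $\sigma=R_u(\xi)$, $r=h_u(\xi)$, $y=(r,v)$. If $\xi(y)\ne n$ or $r<\lambda_v$, $R'_u(\xi)=\sigma$. Otherwise let $\{s,\dots,s+k\}$ be the set of all columns $j$ with $\lambda_j=\lambda_v$, $v'=2s+k-v$, and $R'_u(\xi)=\tau_{v'-1}\circ\cdots\circ\tau_{v}(\sigma)$ if $v<v'$, $=\sigma$ if $v=v'$, $=\tau_{v'}\circ\cdots\circ\tau_{v-1}(\sigma)$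 if $v>v'$ (rightmost operator applied first).
   Formalization: In the set Q the third case ''c<b<a'' is replaced by ''c<a<b'' (cyclic order), in both quinv and the operators τ_j; with ''c<b<a'' balance fails for λ=(2,1), n=3, t≠1 at σ(2,1)=3, σ(1,1)=2, σ(1,2)=1. *)

(* Defs.v *)
From HB Require Import structures.
From mathcomp Require Import all_boot all_order all_algebra.
Set Implicit Arguments. Unset Strict Implicit. Unset Printing Implicit Defensive.
Import Order.TTheory GRing.Theory Num.Theory.

Definition is_partition (lam : seq nat) : bool :=
  sorted geq lam && (0 \notin lam).

(* lambda_c, columns indexed from 1 *)
Definition lamc (lam : seq nat) (c : nat) : nat := nth 0 lam c.-1.

(* cells of dg(lambda): a pair (column index c-1, row index r-1) with r <= lambda_c *)
Notation cell lam :=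
  {p : 'I_(size lam) * 'I_(foldr maxn 0 lam) | p.2 < nth 0 lam p.1}.

(* Tab(lambda, n): entry k : 'I_n stands for the value k+1 in [n] *)
Notation Tab lam n := {ffun cell lam -> 'I_n}.

Definition rowc lam (u : cell lam) : nat := (val u).2.+1.
Definition colc lam (u : cell lam) : nat := (val u).1.+1.

(* raw fillings: f r c = entry in row r, column c (1-indexed), 0 outside dg *)
Definition rawfill := nat -> nat -> nat.

Definition fill lam n (s : Tab lam n) : rawfill := fun r c =>
  if [pick w : cell lam | (rowc w == r) && (colc w == c)] is Some w
  then (s w).+1 else 0.

Definition inQ (a b c : nat) : bool :=
  [|| (a < b < c), (b < c < a), (c < a < b) | (a == b) && (b != c)].

Definition quinv lam n (s : Tab lam n) : nat :=
  let f := fill s in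
  \sum_(u : cell lam)
    \sum_(v : cell lam | (rowc u == rowc v) && (colc u < colc v))
       inQ (f (rowc u).+1 (colc u)) (f (rowc u) (colc u)) (f (rowc v) (colc v)).

Definition wt (R : nzRingType) lam n (x : nat -> R) (t : R) (s : Tab lam n) : R :=
  (t ^+ quinv s * \prod_(u : cell lam) x (s u).+1)%R.

(* sigma(S(u)) <> sigma(u), with sigma(S(u)) = infinity in the bottom row *)
Definition south_ok (f : rawfill) (r c : nat) : bool :=
  (r == 1) || (f r.-1 c != f r c).

Definition down lam n (s : Tab lam n) (u : cell lam) : nat :=
  #|[pred y : cell lam |
      (((rowc y == rowc u) && (colc y < colc u))
       || ((rowc y == (rowc u).-1) && (colc u < colc y)))
      && (s y == s u)]|.

Definition ringh lam (n : nat) (f : rawfill) (r c : nat) : nat :=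
  \max_(r <= h < (lamc lam c).+1 |
        all (fun i => f i.+1 c + n - f i c == 1 %[mod n]) (iota r (h - r))) h.

Definition ring (n : nat) (f : rawfill) (c r h : nat) : rawfill := fun i j =>
  if (j == c) && (r <= i <= h) then f i j %% n + 1 else f i j.

(* tau_j (used only when lambda_j = lambda_{j+1}) *)
Definition tau lam (f : rawfill) (j : nat) : rawfill :=
  let h := lamc lam j in
  let a i := f i j in
  let b i := f i j.+1 in
  let rmax := maxn 1 (\max_(2 <= r < h.+1 |
                 inQ (a r) (a r.-1) (b r.-1) == inQ (b r) (a r.-1) (b r.-1)) r) in
  fun i k => if rmax <= i <= h then
               (if k == j then f i j.+1 else if k == j.+1 then f i j else f i k)
             else f i k.

Definition Rprime lam (n : nat) (f : rawfill) (r' v : nat) : rawfill :=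
  let r := ringh lam n f r' v in
  let g := ring n f v r' r in
  if (f r v != n) || (r < lamc lam v) then g else
  let s := (index (lamc lam v) lam).+1 in
  let k := (count_mem (lamc lam v) lam).-1 in
  let v' := 2 * s + k - v in
  if v <= v' then foldl (fun g j => tau lam g j) g (iota v (v' - v))
  else foldl (fun g j => tau lam g j) g (rev (iota v' (v - v'))).

Definition rate (R : fieldType) lam n (x : nat -> R) (t : R) (s s' : Tab lam n) : R :=
  \sum_(u : cell lam | south_ok (fill s) (rowc u) (colc u) &&
          [forall w : cell lam,
             Rprime lam n (fill s) (rowc u) (colc u) (rowc w) (colc w) == (s' w).+1])
     ((x (s u).+1)^-1 * t ^+ down s u)%R.

Definition is_stationary (R : nzRingType) (T : finType) (pi : T -> R) (q : T -> T -> R) :=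
  forall s : T, (\sum_(s' : T) pi s' * q s' s = pi s * \sum_(s' : T) q s s')%R.

(* Main.v *)
(**
Every transition out of [xi] through a cell [u] ends with a distinguished cell
[y], the top of the ringing path (in its new column once the operators [tau]
have been applied), and [y] differs from its northern neighbour in the new
filling. The resulting map on pairs (filling, cell) is injective from
{S(u) <> u} to {N(y) <> y}, and transports the flow [wt xi / x_u * t^down] to
[wt sigma / x_y * t^up], where [up] counts the entries equal to [sigma y] in the
arm of N(y): incrementing the path changes quinv by down - up, and when the top
entry wraps from n to 1 the operators [tau] compensate the pairs of top cells of
columns of equal height, an adjacent [tau] changing quinv only through the two
top entries.

Reading the cells row by row, the number N of columns whose most recent entry is
[a] goes up at each [u] with S(u) <> u = a and down when passing N(y) for each
[y = a] with N(y) <> y. Since [down] and [up] are the values of N before the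
former and after the latter steps, the q-integers [N]_t telescope, which gives
sum t^down = sum t^up for each filling and each value [a]. At t = 1 this shows
that the injection above is a bijection; for general t it turns the total inflow
into the total outflow.
*)
Require Import Defs.
From HB Require Import structures.
From mathcomp Require Import all_boot all_order all_algebra zify.
Import Order.TTheory GRing.Theory Num.Theory.
Set Implicit Arguments. Unset Strict Implicit. Unset Printing Implicit Defensive.

(** * The cyclic order on triples *)

(* [inQ x b c] says that [x] lies on the cyclic arc (c, b], empty if b = c. *)
Lemma inQ_swap x b c : b != c -> inQ x c b = ~~ inQ x b c.
Proof.
rewrite /inQ; case: (ltngtP x b); case: (ltngtP b c); case: (ltngtP x c) => //=; lia.
Qed.

Lemma inQ_diag x b : inQ x b b = false.
Proof. rewrite /inQ; apply: negbTE; apply/negP; lia. Qed.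

(** The arcs (c, b], (b, a] and (a, c] together run round the circle a whole number of times, so the
    number of them that contain x does not depend on x. The right side is its value at x = a. *)
Lemma inQ_cocycle x a b c :
  inQ x b c + inQ x a b + inQ x c a = inQ a b c + inQ a a b + inQ a c a.
Proof.
rewrite /inQ !ltnn !eqxx /=.
case: (ltngtP x a) => h1; case: (ltngtP a b) => h2;
case: (ltngtP x b) => h3; try (exfalso; lia);
case: (ltngtP b c) => h4; case: (ltngtP x c) => h5; try (exfalso; lia);
case: (ltngtP a c) => h6; try (exfalso; lia); by [].
Qed.

(** By the cocycle and complementation, the hypothesis makes the difference of [inQ x b c] and
    [inQ x a c] the same at x = a' and x = b'. This serves at the lowest row swapped by [tau], where
    the entries below stay in place. *)
Lemma inQ_exchange a' b' a b c : inQ a' a b = inQ b' a b ->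
  inQ a' a c + inQ b' b c = inQ b' a c + inQ a' b c.
Proof.
move=> e; have := inQ_cocycle a' a b c; have := inQ_cocycle b' a b c.
rewrite e => <-.
case: (eqVneq a c) => [<-|ac]; last by rewrite !(inQ_swap _ ac); lia.
case: (eqVneq a b) => [<-|ab]; first by rewrite !inQ_diag.
by rewrite !(inQ_swap _ ab) !inQ_diag e.
Qed.

Lemma inQ0 b c : inQ 0 b c = (0 < b < c) || ((b == 0) && (c != 0)).
Proof. by apply/idP/idP; rewrite /inQ; lia. Qed.

Definition incr n b := b %% n + 1.

Lemma incrE n b : 0 < b <= n -> incr n b = if b == n then 1 else b.+1.
Proof.
move=> h; rewrite /incr; case: eqP => [->|?]; first by rewrite modnn.
by rewrite modn_small; lia.
Qed.

Lemma incr_range n b : 0 < n -> 0 < incr n b <= n.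
Proof. by move=> n0; rewrite /incr addn1 /= ltn_mod. Qed.

Lemma incr_inj n a b : 0 < a <= n -> 0 < b <= n -> incr n a = incr n b -> a = b.
Proof. by move=> ha hb; rewrite !incrE //; do 2 case: eqP; lia. Qed.

(** A point moved one step enters the arc (c, s] only from c and leaves it only from s; the latter
    is excluded. Used just below the bottom of a path. *)
Lemma inQ_incr1 n a s c : 0 < a <= n -> 0 < s <= n -> 0 < c <= n -> a <> s ->
  inQ (incr n a) s c = inQ a s c + (c == a) :> nat.
Proof.
move=> ha hs hc; rewrite incrE // /inQ.
case: eqP => [->|] ?; case: (ltngtP s c) => ? //=;
case: (ltngtP a s) => ? //=; case: (ltngtP a c) => ? //=; try lia;
case: (ltngtP 1 s) => ? //=; case: (ltngtP 1 c) => ? //=; lia.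
Qed.

Lemma inQ_incr_self n a c : 0 < a <= n -> 0 < c <= n -> inQ (incr n a) a c = false.
Proof.
move=> ha hc; apply/negbTE/negP; rewrite incrE // /inQ; case: eqP => ?; lia.
Qed.

(* The entry 0 above a column breaks the cyclic symmetry only when [b] wraps from
   [n] to [1], whence the condition [(d == 0) ==> (b != n)]. *)
Lemma inQ_incr2 n d b c : d <= n -> 0 < b <= n -> 0 < c <= n -> d != incr n b ->
  (d == 0) ==> (b != n) ->
  inQ d (incr n b) c + (c == incr n b) = inQ d b c.
Proof.
move=> hd hb hc; rewrite incrE // /inQ.
case: (eqVneq b n) => [->|] ? /=; [case: (ltngtP d 1)| case: (ltngtP d b)] => ? /=;
 case: (ltngtP d c) => ? //=; lia.
Qed.

(** Advancing the lower end of (b, d] removes the point [incr n b], unless b = d, when the empty arc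
    becomes everything but that point. *)
Lemma inQ_incr3 n e d b : e <= n -> 0 < d <= n -> 0 < b <= n ->
  (e == 0) ==> (b != n) ->
  inQ e d (incr n b) + (e == incr n b) = inQ e d b + (d == b).
Proof.
move=> he hd hb; rewrite incrE // /inQ.
case: (eqVneq b n) => [->|] ? /=; [case: (ltngtP d 1)| case: (ltngtP d b)] => ? //=;
case: (ltngtP d e) => ? //=; lia.
Qed.

(** * Effect of ringing a path on quinv *)

Definition pairsum L (A : nat -> nat -> nat) :=
  \sum_(1 <= i < L.+1) \sum_(i.+1 <= j < L.+1) A i j.

(** Sets apart the pairs that involve column v, the only ones affected by ringing a path there. *)
Lemma pairsum_split1 L A v : 0 < v <= L ->
  pairsum L A = \sum_(1 <= i < v) A i v + \sum_(v.+1 <= j < L.+1) A v j +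
   (\sum_(1 <= i < v) (\sum_(i.+1 <= j < v) A i j + \sum_(v.+1 <= j < L.+1) A i j) +
    \sum_(v.+1 <= i < L.+1) \sum_(i.+1 <= j < L.+1) A i j).
Proof.
move=> /andP[v0 vL]; rewrite /pairsum (@big_cat_nat _ _ _ v) //=; last by lia.
rewrite [X in _ + X]big_ltn // addnA.
rewrite (eq_big_nat _ _ (F2 := fun i => A i v +
   (\sum_(i.+1 <= j < v) A i j + \sum_(v.+1 <= j < L.+1) A i j))).
  by rewrite big_split /=; lia.
move=> i /andP[i0 iv]; rewrite (@big_cat_nat _ _ _ v) //=; last by lia.
by rewrite [X in _ + X]big_ltn //; lia.
Qed.

(** Columns v and v + 1 are kept together against each other column, because [tau] preserves only
    the sum of their two contributions. *)
Lemma pairsum_split2 L A v : 0 < v < L ->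
  pairsum L A = \sum_(1 <= i < v) (A i v + A i v.+1) +
     \sum_(v.+2 <= j < L.+1) (A v j + A v.+1 j) + A v v.+1 +
   (\sum_(1 <= i < v) (\sum_(i.+1 <= j < v) A i j + \sum_(v.+2 <= j < L.+1) A i j) +
    \sum_(v.+2 <= i < L.+1) \sum_(i.+1 <= j < L.+1) A i j).
Proof.
move=> /andP[v0 vL]; rewrite /pairsum (@big_cat_nat _ _ _ v) //=; last by lia.
rewrite (@big_ltn _ _ _ v L.+1); last by lia.
rewrite (@big_ltn _ _ _ v.+1 L.+1 (A v)); last by lia.
rewrite (@big_ltn _ _ _ v.+1 L.+1); last by lia.
rewrite (eq_big_nat _ _ (F2 := fun i => (A i v + A i v.+1) +
   (\sum_(i.+1 <= j < v) A i j + \sum_(v.+2 <= j < L.+1) A i j))).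
  by rewrite !big_split /=; lia.
move=> i /andP[i0 iv]; rewrite (@big_cat_nat _ _ _ v) //=; last by lia.
rewrite (@big_ltn _ _ _ v L.+1); last by lia.
by rewrite (@big_ltn _ _ _ v.+1 L.+1); lia.
Qed.

(** Telescoping without subtraction or division, so that it serves for sums and for products
    alike. *)
Lemma big_nat_shift (T : Type) (idx : T) (op : Monoid.com_law idx) r h (D : nat -> T) :
  r <= h.+1 ->
  op (\big[op/idx]_(r <= i < h.+1) D i.+1) (D r) =
  op (\big[op/idx]_(r <= i < h.+1) D i) (D h.+1).
Proof.
move=> rh; rewrite Monoid.mulmC -(big_nat_recl h.+1 r) //.
by rewrite big_nat_recr.
Qed.

Lemma sum_nat_delta k m P :
  \sum_(1 <= i < m.+1) ((i == k) && P : nat) = (0 < k <= m) && P :> nat.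
Proof.
elim: m => [|m ih]; first by rewrite big_geq //; case: k.
rewrite big_nat_recr //= {}ih.
by case: P; rewrite ?andbF ?andbT //=; case: eqP => /= ?; lia.
Qed.

Section Raw.
Variable lam : seq nat.
Local Notation hgt := (lamc lam).
Local Notation L := (size lam).

Definition in_dg r c := (0 < c) && (0 < r <= hgt c).

(** The value 0 outside the diagram is the prescribed entry above a column. In row 0 it stands in
    for infinity, as it also differs from every entry. *)
Definition valid n (f : rawfill) :=
  forall r c, if in_dg r c then 0 < f r c <= n else f r c == 0.

Definition colq (f : rawfill) i j :=
  \sum_(1 <= r < (hgt j).+1) (inQ (f r.+1 i) (f r i) (f r j) : nat).

Definition quinvr f := pairsum L (colq f).

(** For a > 0, positions outside the diagram hold 0 and are not counted. Taken in row r + 1, this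
    describes the arm of the northern neighbour, even when that neighbour lies outside the
    diagram. *)
Definition armc (f : rawfill) a r c :=
  \sum_(1 <= j < c) (f r j == a : nat) + \sum_(c.+1 <= j < L.+1) (f r.-1 j == a : nat).

Lemma valid_in n f r c : valid n f -> in_dg r c -> 0 < f r c <= n.
Proof. by move=> /(_ r c); case: in_dg. Qed.

Lemma valid_out n f r c : valid n f -> ~~ in_dg r c -> f r c = 0.
Proof. by move=> /(_ r c); case: in_dg => // /eqP. Qed.

Lemma valid_le n f r c : valid n f -> f r c <= n.
Proof. by move=> /(_ r c); case: in_dg => [/andP[]//|/eqP->]. Qed.

Lemma ringE n f c r h i j : ring n f c r h i j =
  if (j == c) && (r <= i <= h) then incr n (f i j) else f i j.
Proof. by []. Qed.

Lemma valid_ring n f c r h : valid n f -> 0 < n -> 0 < c -> 0 < r -> h <= hgt c ->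
  valid n (ring n f c r h).
Proof.
move=> vf n0 c0 r0 hh i j; have := vf i j; rewrite ringE.
case: (boolP ((j == c) && (r <= i <= h))) => // /andP[/eqP-> ri]; rewrite (_ : in_dg i c) ?incr_range //.
rewrite /in_dg; lia.
Qed.

Hypothesis hgt_mono : forall i j, 0 < i <= j -> hgt j <= hgt i.

Lemma hgt_pos_size c : 0 < hgt c -> c <= L.
Proof.
by move=> h; case: (leqP c L) => // hc; move: h; rewrite /lamc nth_default //; lia.
Qed.

Section Ring.
Variables (n : nat) (f : rawfill) (r v h : nat).
Hypotheses (n_gt0 : 0 < n) (vf : valid n f) (v_gt0 : 0 < v) (r_gt0 : 0 < r).
Hypotheses (rh : r <= h) (hv : h <= hgt v) (sok : south_ok f r v).
Hypothesis path : forall i, r <= i < h -> f i.+1 v = incr n (f i v).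
Hypothesis stop : h < hgt v -> f h.+1 v <> incr n (f h v).
Let f' := ring n f v r h.
Let wrap := (h == hgt v) && (f h v == n).

(** Only rows r - 1 and h matter. Inside the path the upper entry of column v is the successor of
    the lower one, before and after ringing, so these terms vanish by [inQ_incr_self]. *)
Lemma ring_colq_right j : v < j ->
  colq f' v j + (f h j == incr n (f h v)) =
  colq f v j + (f r.-1 j == f r v) + (wrap && (h <= hgt j)).
Proof.
move=> vj; have hj : hgt j <= hgt v by apply: hgt_mono; lia.
have E1 : (f h j == incr n (f h v)) = (0 < h <= hgt j) && (f h j == incr n (f h v)).
  case: (boolP (0 < h <= hgt j)) => //= hh.
  rewrite (@valid_out n) //; last by rewrite /in_dg; lia.
  by have := incr_range (f h v) n_gt0; lia.
have dgr : in_dg r v by rewrite /in_dg; lia.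
have E2 : (f r.-1 j == f r v) = (0 < r.-1 <= hgt j) && (f r.-1 j == f r v).
  case: (boolP (0 < r.-1 <= hgt j)) => //= hh.
  rewrite (@valid_out n) //; last by rewrite /in_dg; lia.
  by have := valid_in vf dgr; lia.
have E3 : wrap && (h <= hgt j) = (0 < h <= hgt j) && wrap by rewrite andbC; lia.
(* Each indicator is written as a sum over the rows with at most one nonzero term, so that the
   identity can be checked row by row. *)
rewrite E1 E2 E3 -!sum_nat_delta -!big_split /=.
apply: eq_big_nat => i /andP[i0 ij].
have jv : j == v = false by lia.
have dj : in_dg i j by rewrite /in_dg; lia.
have di : in_dg i v by rewrite /in_dg; lia.
have := valid_in vf dj; have := valid_in vf di => biR cR.
rewrite /f' !ringE jv eqxx /=.
case: (ltnP i r.-1) => [ir|ri].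
  have -> : (r <= i.+1 <= h) = false by lia.
  have -> : (r <= i <= h) = false by lia.
  have -> : (i == h) = false by lia.
  have -> : (i == r.-1) = false by lia.
  lia.
case: (eqVneq i r.-1) => [ir|nir] /=.
  have -> : (r <= i.+1 <= h) = true by lia.
  have -> : (r <= i <= h) = false by lia.
  have -> : (i == h) = false by lia.
  have -> : i.+1 = r by lia.
  rewrite inQ_incr1 ?(valid_in vf) //; first by rewrite ir; lia.
  move: sok; rewrite /south_ok -ir; case: eqP => [|_ /eqP]; first lia.
  by move=> ? ?; lia.
have ri' : r <= i by lia.
have [ih|hi] : i < h \/ h <= i by lia.
  have -> : (r <= i.+1 <= h) = true by lia.
  have -> : (r <= i <= h) = true by lia.
  have -> : (i == h) = false by lia.
  rewrite path; last by lia.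
  by rewrite !inQ_incr_self ?incr_range.
have -> : (r <= i.+1 <= h) = false by lia.
case: (eqVneq i h) => [ih|nih] /=; last first.
  by have -> : (r <= i <= h) = false; [lia | rewrite !addn0].
have -> : (r <= i <= h) = true by lia.
rewrite -ih addn0; case: (boolP wrap) => /= [/andP[/eqP hh /eqP fn]|nw].
  have -> : f i.+1 v = 0 by apply: (@valid_out n) => //; rewrite /in_dg; lia.
  rewrite ih in cR *; rewrite fn (incrE (n := n)) ?eqxx; last lia.
  by rewrite !inQ0; lia.
rewrite addn0; apply: inQ_incr2 => //; first exact: valid_le vf.
  case: (ltnP h (hgt v)) => hh; first by rewrite ih; apply/eqP/stop.
  rewrite (@valid_out n _ i.+1 v) //; last by rewrite /in_dg; lia.
  by have := incr_range (f i v) n_gt0; lia.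
apply/implyP => /eqP e0; move: nw; rewrite /wrap -ih negb_and.
case: (eqVneq i (hgt v)) => //= ne _.
by have := @valid_in n f i.+1 v vf; rewrite e0 /in_dg; lia.
Qed.

(* The row contributions telescope because [incr n (f i v) = f i.+1 v] on the path. *)
Lemma ring_colq_left j : 0 < j < v ->
  colq f' j v + (f h.+1 j == incr n (f h v)) + (wrap && (hgt j == h)) =
  colq f j v + (f r j == f r v).
Proof.
move=> jv; have hj : hgt v <= hgt j by apply: hgt_mono; lia.
(* [D i] compares columns j and v in row i, the path being prolonged above its top by
   [incr n (f h v)]. Then [inQ_incr3] in row i exchanges [D i] for [D i.+1]. *)
pose D i := (f i j == if i <= h then f i v else incr n (f h v)) : nat.
have -> : (f h.+1 j == incr n (f h v)) = D h.+1 :> nat by rewrite /D ltnn.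
have -> : (f r j == f r v) = D r :> nat by rewrite /D rh.
suff E : colq f' j v + \sum_(r <= i < h.+1) D i.+1 + (wrap && (hgt j == h)) =
         colq f j v + \sum_(r <= i < h.+1) D i.
  by have := @big_nat_shift _ 0 addn r h D (leqW rh) => /= ?; lia.
have split g : colq g j v = \sum_(1 <= i < r) (inQ (g i.+1 j) (g i j) (g i v) : nat)
   + \sum_(r <= i < h.+1) (inQ (g i.+1 j) (g i j) (g i v) : nat)
   + \sum_(h.+1 <= i < (hgt v).+1) (inQ (g i.+1 j) (g i j) (g i v) : nat).
  rewrite /colq (@big_cat_nat _ _ _ r) //=; last by lia.
  by rewrite -addnA; congr (_ + _); apply: big_cat_nat; lia.
have jv' : j == v = false by lia.
rewrite !split.
have -> : \sum_(1 <= i < r) (inQ (f' i.+1 j) (f' i j) (f' i v) : nat) =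
          \sum_(1 <= i < r) (inQ (f i.+1 j) (f i j) (f i v) : nat).
  apply: eq_big_nat => i ?; rewrite /f' !ringE jv' eqxx /=.
  by have -> : (r <= i <= h) = false by lia.
have -> : \sum_(h.+1 <= i < (hgt v).+1) (inQ (f' i.+1 j) (f' i j) (f' i v) : nat) =
          \sum_(h.+1 <= i < (hgt v).+1) (inQ (f i.+1 j) (f i j) (f i v) : nat).
  apply: eq_big_nat => i ?; rewrite /f' !ringE jv' eqxx /=.
  by have -> : (r <= i <= h) = false by lia.
suff : \sum_(r <= i < h.+1) (inQ (f' i.+1 j) (f' i j) (f' i v) : nat) +
    \sum_(r <= i < h.+1) D i.+1 + (wrap && (hgt j == h)) =
    \sum_(r <= i < h.+1) (inQ (f i.+1 j) (f i j) (f i v) : nat) +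
    \sum_(r <= i < h.+1) D i by lia.
have step i : r <= i <= h -> ~~ ((i == h) && (wrap && (hgt j == h))) ->
   inQ (f' i.+1 j) (f' i j) (f' i v) + D i.+1 = inQ (f i.+1 j) (f i j) (f i v) + D i.
  move=> ri nw; rewrite /f' !ringE jv' eqxx ri /=.
  have -> : D i.+1 = (f i.+1 j == incr n (f i v)).
    rewrite /D; case: ltnP => ih; first by rewrite path //; lia.
    by have -> : i = h by lia.
  have -> : D i = (f i j == f i v) by rewrite /D; have -> : i <= h by lia.
  apply: inQ_incr3; first exact: valid_le vf.
  - by apply: valid_in vf _; rewrite /in_dg; lia.
  - by apply: valid_in vf _; rewrite /in_dg; lia.
  apply/implyP => /eqP e0; have := @valid_in n f i.+1 j vf; rewrite e0 /in_dg.
  move: nw; rewrite /wrap; case: (eqVneq i h) => [<-|] /=; lia.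
rewrite !big_nat_recr //=.
have E : \sum_(r <= i < h) (inQ (f' i.+1 j) (f' i j) (f' i v) : nat) +
    \sum_(r <= i < h) D i.+1 =
    \sum_(r <= i < h) (inQ (f i.+1 j) (f i j) (f i v) : nat) +
    \sum_(r <= i < h) D i.
  by rewrite -!big_split /=; apply: eq_big_nat => i ?; apply: step; lia.
suff : inQ (f' h.+1 j) (f' h j) (f' h v) + D h.+1 + (wrap && (hgt j == h)) =
   inQ (f h.+1 j) (f h j) (f h v) + D h by lia.
(* Here both columns end in row h, the entry above is 0 and the cyclic argument fails; the term is
   computed directly. *)
case: (boolP (wrap && (hgt j == h))) => [/andP[/andP[/eqP hh /eqP fn] /eqP hjh]|nw].
  rewrite /f' !ringE jv' eqxx rh leqnn /=.
  have -> : D h.+1 = 0.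
    rewrite /D ltnn (@valid_out n) //; last by rewrite /in_dg; lia.
    by have := incr_range (f h v) n_gt0; lia.
  have := @valid_in n f h j vf; rewrite /in_dg.
  have -> : f h.+1 j = 0 by apply: (@valid_out n) => //; rewrite /in_dg; lia.
  rewrite /D leqnn fn (incrE (n := n)) ?eqxx ?inQ0; last lia.
  by lia.
by rewrite addn0; apply: step; [lia | rewrite eqxx].
Qed.

Lemma armc_ring a k : h < k -> armc f' a k v = armc f a k v.
Proof.
move=> hk; rewrite /armc; congr (_ + _); apply: eq_big_nat => i ?;
by rewrite /f' ringE; have -> : (i == v) = false by lia.
Qed.

(** The two column lemmas are summed over j. When the top entry wraps, the corrections count the
    columns of the same height as v on either side of it; the operators [tau] will compensate
    them. *)
Lemma quinvr_ring :
  quinvr f' + armc f' (f' h v) h.+1 v + wrap * (\sum_(1 <= j < v) (hgt j == h : nat))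
  = quinvr f + armc f (f r v) r v + wrap * (\sum_(v.+1 <= j < L.+1) (h <= hgt j : nat)).
Proof.
have vL : 0 < v <= L by rewrite v_gt0 hgt_pos_size //; lia.
rewrite armc_ring // /quinvr !(pairsum_split1 _ vL).
set X := (X in _ + _ + X + _ + _ = _); set Y := (Y in _ = _ + _ + Y + _ + _).
have -> : X = Y.
  have E i j : i != v -> j != v -> colq f' i j = colq f i j.
    move=> iv jv; apply: eq_big_nat => k _.
    by rewrite /f' !ringE (negbTE iv) (negbTE jv).
  congr (_ + _).
    by apply: eq_big_nat => i ?; congr (_ + _); apply: eq_big_nat => j ?; apply: E; lia.
  by apply: eq_big_nat => i ?; apply: eq_big_nat => j ?; apply: E; lia.
have -> : f' h v = incr n (f h v) by rewrite /f' ringE eqxx rh leqnn.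
rewrite /armc !big_distrr /=.
have A : \sum_(v.+1 <= j < L.+1) colq f' v j +
    \sum_(v.+1 <= j < L.+1) (f h j == incr n (f h v) : nat) =
    \sum_(v.+1 <= j < L.+1) colq f v j + \sum_(v.+1 <= j < L.+1) (f r.-1 j == f r v : nat)
   + \sum_(v.+1 <= j < L.+1) wrap * (h <= hgt j).
  rewrite -!big_split /=; apply: eq_big_nat => j ?; rewrite ring_colq_right; lia.
have B : \sum_(1 <= j < v) colq f' j v +
    \sum_(1 <= j < v) (f h.+1 j == incr n (f h v) : nat) +
    \sum_(1 <= j < v) wrap * (hgt j == h) =
    \sum_(1 <= j < v) colq f j v + \sum_(1 <= j < v) (f r j == f r v : nat).
  by rewrite -!big_split /=; apply: eq_big_nat => j ?; rewrite -ring_colq_left // mulnb.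
lia.
Qed.

End Ring.
End Raw.

(** * Births and deaths of a value along the reading order *)

Lemma bigmax_nat_spec m k (P : pred nat) (M := \max_(m <= r < k | P r) r) :
  (forall r, m <= r < k -> P r -> r <= M) /\ (M = 0 \/ (m <= M < k) && P M).
Proof.
rewrite {}/M big_mkcond; elim: k => [|k [ih1 ih2]].
  by rewrite big_geq //; split; [lia | left].
case: (leqP m k) => mk; last by rewrite big_geq //; split; [lia | left].
rewrite big_nat_recr //=; set M := (\big[_/_]_(_ <= _ < _) _) in ih1 ih2 *.
split=> [r rk Pr|].
  case: (eqVneq r k) => [<-|rk']; first by rewrite Pr leq_maxr.
  by apply: leq_trans (leq_maxl _ _); apply: ih1 => //; lia.
case: ifP => Pk; last by rewrite maxn0; case: ih2 => [->|/andP[? ->]]; [left|right; lia].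
have Mk : M <= k by case: ih2; lia.
by right; rewrite (maxn_idPr Mk) Pk; lia.
Qed.

Section BirthDeath.
Variables (R : comNzRingType) (t : R) (lam : seq nat) (n : nat) (f : rawfill).
Local Notation hgt := (lamc lam).
Local Notation L := (size lam).
Hypothesis hgt_mono : forall i j, 0 < i <= j -> hgt j <= hgt i.
Hypothesis vf : valid lam n f.
Local Open Scope ring_scope.

(* The number of columns whose last entry before the cell (r, c) is [a], when the
   cells are read row by row. *)
Let cnt (a r c : nat) : nat :=
  (\sum_(1 <= j < c) (f r j == a : nat) + \sum_(c <= j < L.+1) (f r.-1 j == a : nat))%N.
Let G k : R := \sum_(i < k) t ^+ i.

(** Reading the cell (r, c) replaces [f r.-1 c] by [f r c] among the last entries, while the other
    columns contribute m = [armc lam f a r c] to the count. A birth or a death therefore changes [G]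
    by its increment t^m between m and m + 1. *)
Lemma birth_death_row (a r k : nat) : (k <= L)%N ->
  \sum_(1 <= c < k.+1) (if (f r c == a) && (f r.-1 c != a) then t ^+ armc lam f a r c else 0)
   + G (cnt a r 1) =
  \sum_(1 <= c < k.+1) (if (f r.-1 c == a) && (f r c != a) then t ^+ armc lam f a r c else 0)
   + G (cnt a r k.+1).
Proof.
elim: k => [|k ih] kL; first by rewrite !big_geq.
rewrite !(@big_nat_recr _ _ _ k.+1) //= addrAC ih 1?ltnW //.
rewrite -!addrA; congr (_ + _).
have -> : cnt a r k.+1 = (armc lam f a r k.+1 + (f r.-1 k.+1 == a))%N.
  by rewrite /cnt /armc (@big_ltn _ _ _ k.+1) //; lia.
have -> : cnt a r k.+2 = (armc lam f a r k.+1 + (f r k.+1 == a))%N.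
  by rewrite /cnt /armc big_nat_recr //=; lia.
case: (f r k.+1 == a); case: (f r.-1 k.+1 == a);
  by rewrite /= ?addn0 ?addr0 ?add0r // addn1 /G big_ord_recr // addrC.
Qed.

Lemma birth_death_value (a : nat) : (0 < a)%N ->
  \sum_(1 <= r < (hgt 1).+1) \sum_(1 <= c < L.+1)
    (if (f r c == a) && (f r.-1 c != a) then t ^+ armc lam f a r c else 0) =
  \sum_(1 <= r < (hgt 1).+1) \sum_(1 <= c < L.+1)
    (if (f r c == a) && (f r.+1 c != a) then t ^+ armc lam f a r.+1 c else 0).
Proof.
move=> a0.
have out (r c : nat) : (0 < c)%N -> (r == 0%N) || (hgt 1 < r)%N -> f r c = 0%N.
  move=> c0 hr; apply: valid_out vf _; have := @hgt_mono 1%N c; rewrite /in_dg; lia.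
pose B r := \sum_(1 <= c < L.+1)
    (if (f r c == a) && (f r.-1 c != a) then t ^+ armc lam f a r c else 0).
pose D r := \sum_(1 <= c < L.+1)
    (if (f r.-1 c == a) && (f r c != a) then t ^+ armc lam f a r c else 0).
have tele k : \sum_(1 <= r < k.+1) B r + G (cnt a 1 1) =
              \sum_(1 <= r < k.+1) D r + G (cnt a k.+1 1).
  elim: k => [|k ih]; first by rewrite !big_geq.
  rewrite !(@big_nat_recr _ _ _ k.+1) //= addrAC ih addrAC -!addrA; congr (_ + _).
  rewrite /B /D birth_death_row //; congr (_ + G _).
  by rewrite /cnt /= (@big_geq _ _ _ L.+1 L.+1) // (@big_geq _ _ _ 1%N 1%N) //= addn0 add0n.
(* One row beyond the tallest column is included: every remaining a dies there, so the count returns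
   to 0. Shifting the index then attaches each death to the cell just below it. *)
have := tele (hgt 1).+1.
have cnt0 (r : nat) : (r == 1)%N || ((hgt 1).+1 < r)%N -> cnt a r 1 = 0%N.
  move=> hr; rewrite /cnt big_geq // big_nat big1 // => c hc.
  by rewrite out //; lia.
rewrite !cnt0 ?eqxx ?ltnSn ?orbT // => /addIr.
rewrite big_nat_recr //= [X in _ + X](_ : _ = 0); last first.
  by rewrite /B big_nat big1 // => c hc; rewrite out; [case: eqP => //=; lia | lia | lia].
rewrite addr0 => ->; rewrite big_nat_recl //= [X in X + _](_ : _ = 0) ?add0r //.
by rewrite /D big_nat big1 // => c hc; rewrite out; [case: eqP => //=; lia | lia | lia].
Qed.

Lemma sum_dg (F : nat -> nat -> R) :
  (forall r c, (0 < c)%N -> (hgt c < r)%N -> F r c = 0) ->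
  \sum_(1 <= c < L.+1) \sum_(1 <= r < (hgt c).+1) F r c =
  \sum_(1 <= r < (hgt 1).+1) \sum_(1 <= c < L.+1) F r c.
Proof.
move=> F0; rewrite [RHS]exchange_big /=; apply: eq_big_nat => c /andP[c0 cL].
have ? := @hgt_mono 1%N c.
rewrite [RHS](@big_cat_nat _ _ _ (hgt c).+1) //=; last lia.
rewrite [X in _ = _ + X](_ : _ = 0) ?addr0 // big_nat big1 // => r hr; apply: F0; lia.
Qed.

(** The cells are sorted by their value a, and [birth_death_value] is applied to each a with
    coefficient [y a]. *)
Lemma birth_death (y : nat -> R) :
  \sum_(1 <= c < L.+1) \sum_(1 <= r < (hgt c).+1)
    (if south_ok f r c then y (f r c) * t ^+ armc lam f (f r c) r c else 0) =
  \sum_(1 <= c < L.+1) \sum_(1 <= r < (hgt c).+1)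
    (if f r.+1 c != f r c then y (f r c) * t ^+ armc lam f (f r c) r.+1 c else 0).
Proof.
have dec (T : nat -> nat -> nat -> R) (c r : nat) :
   (0 < c)%N -> (0 < r < (hgt c).+1)%N ->
   y (f r c) * T (f r c) r c =
   \sum_(1 <= a < n.+1) y a * (if f r c == a then T a r c else 0).
  move=> c0 hr; have := @valid_in lam n f r c vf; rewrite /in_dg => hin.
  rewrite (@bigD1_seq _ _ _ _ _ (f r c)) ?iota_uniq //=; last first.
    by rewrite mem_index_iota; lia.
  rewrite eqxx big1 ?addr0 // => a; rewrite eq_sym => /negbTE->.
  by rewrite mulr0.
have main (b : nat -> nat -> nat -> bool) (b' : nat -> nat -> bool) (T : nat -> nat -> nat -> R) :
  (forall c r, (0 < c)%N -> (0 < r < (hgt c).+1)%N -> b (f r c) r c = b' r c) ->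
  \sum_(1 <= c < L.+1) \sum_(1 <= r < (hgt c).+1)
    (if b' r c then y (f r c) * T (f r c) r c else 0) =
  \sum_(1 <= a < n.+1) y a * \sum_(1 <= r < (hgt 1).+1) \sum_(1 <= c < L.+1)
   (if (f r c == a) && b a r c then T a r c else 0).
  move=> hb.
  transitivity (\sum_(1 <= a < n.+1) y a * 
     \sum_(1 <= c < L.+1) \sum_(1 <= r < (hgt c).+1)
     (if (f r c == a) && b a r c then T a r c else 0)); last first.
    apply: eq_big_nat => a ha; congr (_ * _); apply: sum_dg => r c c0 hr.
    rewrite (@valid_out lam n f r c vf); last by rewrite /in_dg; lia.
    by case: eqP => //; lia.
  under [RHS]eq_bigr do rewrite big_distrr /=.
  rewrite [RHS]exchange_big /=; apply: eq_big_nat => c /andP[c0 cL].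
  under [RHS]eq_bigr do rewrite big_distrr /=.
  rewrite [RHS]exchange_big /=; apply: eq_big_nat => r hr.
  have := dec (fun a r c => if b a r c then T a r c else 0) c r c0 hr.
  rewrite hb // => E; transitivity (y (f r c) * (if b' r c then T (f r c) r c else 0)).
    by case: ifP => //; rewrite mulr0.
  by rewrite E; apply: eq_bigr => a _; case: eqP.
(* In row 1 the condition [south_ok] agrees with the comparison to row 0, where the entry is 0. *)
rewrite (main (fun a r c => f r.-1 c != a) _ (fun a r c => t ^+ armc lam f a r c)); last first.
  move=> c r c0 hr; rewrite /south_ok; case: (eqVneq r 1%N) => //= ->.
  rewrite (@valid_out lam n f 0 c vf); last by rewrite /in_dg; lia.
  have := @valid_in lam n f 1 c vf; rewrite /in_dg; lia.
rewrite (main (fun a r c => f r.+1 c != a) _ (fun a r c => t ^+ armc lam f a r.+1 c)) //.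
by apply: eq_big_nat => a /andP[a0 _]; rewrite birth_death_value.
Qed.

End BirthDeath.

(** * The operators tau *)

Section Tau.
Variables (lam : seq nat) (j : nat).
Local Notation hgt := (lamc lam).
Local Notation L := (size lam).
Hypothesis hgt_mono : forall i k, 0 < i <= k -> hgt k <= hgt i.
Hypothesis j_gt0 : 0 < j.
Hypothesis hgt_gt0 : 0 < hgt j.
Hypothesis hgtS : hgt j.+1 = hgt j.
Local Notation h := (hgt j).

Definition tau_stop (f : rawfill) r :=
  inQ (f r j) (f r.-1 j) (f r.-1 j.+1) == inQ (f r j.+1) (f r.-1 j) (f r.-1 j.+1).

Definition tau_row f := maxn 1 (\max_(2 <= r < h.+1 | tau_stop f r) r).

Lemma tau_rowP f : [/\ 0 < tau_row f <= h,
  1 < tau_row f -> tau_stop f (tau_row f) &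
  forall r, tau_row f < r <= h -> ~~ tau_stop f r].
Proof.
rewrite /tau_row; case: (bigmax_nat_spec 2 h.+1 (tau_stop f)).
set M := (\max_(_ <= _ < _ | _) _) => maxM defM.
have eM : maxn 1 M = 1 \/ maxn 1 M = M by lia.
split; first by case: defM; lia.
  by case: eM => ->; [lia | case: defM => [->//|/andP[]]].
by move=> r hr; apply/negP => Pr; have := maxM r _ Pr; lia.
Qed.

Lemma tauE f i k : tau lam f j i k =
  if tau_row f <= i <= h then
    (if k == j then f i j.+1 else if k == j.+1 then f i j else f i k)
  else f i k.
Proof. by []. Qed.

Lemma tau_ext f g : f =2 g -> tau lam f j =2 tau lam g j.
Proof.
move=> fg i k; rewrite !tauE !fg.
have -> : tau_row f = tau_row g => //.
by rewrite /tau_row; congr maxn; apply: eq_bigl => r; rewrite /tau_stop !fg.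
Qed.

Lemma tau_off f i k : k != j -> k != j.+1 -> tau lam f j i k = f i k.
Proof. by rewrite tauE => /negbTE-> /negbTE->; case: ifP. Qed.

Lemma tau_top f : tau lam f j h j = f h j.+1 /\ tau lam f j h j.+1 = f h j.
Proof.
have [/andP[_ hm] _ _] := tau_rowP f.
by rewrite !tauE hm leqnn !eqxx /= gtn_eqF.
Qed.

Lemma tau_perm f i :
  (tau lam f j i j = f i j /\ tau lam f j i j.+1 = f i j.+1) \/
  (tau lam f j i j = f i j.+1 /\ tau lam f j i j.+1 = f i j).
Proof. by rewrite !tauE !eqxx (gtn_eqF (ltnSn j)); case: ifP => _; [right|left]. Qed.

Lemma tau_lo f i k : i < tau_row f -> tau lam f j i k = f i k.
Proof. by move=> hi; rewrite tauE leqNgt hi. Qed.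

Lemma tau_hi f i : tau_row f <= i <= h ->
  tau lam f j i j = f i j.+1 /\ tau lam f j i j.+1 = f i j.
Proof. by move=> hi; rewrite !tauE hi !eqxx (gtn_eqF (ltnSn j)). Qed.

(** Swapping the upper pair exchanges the two sides of the equality. Swapping the lower pair
    complements both, or leaves both false if its entries agree. Hence [tau] finds the same row
    again and is an involution. *)
Lemma tau_stop_tau f r : 2 <= r <= h -> tau_stop (tau lam f j) r = tau_stop f r.
Proof.
move=> hr; have [hm _ _] := tau_rowP f; rewrite /tau_stop.
case: (ltngtP r (tau_row f)) => hrm; first by rewrite !tau_lo //; lia.
  have [|-> ->] := @tau_hi f r; [lia|].
  have [|-> ->] := @tau_hi f r.-1; [lia|].
  case: (eqVneq (f r.-1 j) (f r.-1 j.+1)) => [->|ne]; first by rewrite !inQ_diag.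
  by rewrite !(inQ_swap _ ne) eq_sym; do 2 case: inQ.
have [|-> ->] := @tau_hi f r; [lia|].
have lo k : tau lam f j r.-1 k = f r.-1 k by apply: tau_lo; lia.
by rewrite !lo eq_sym.
Qed.

Lemma tauK f : tau lam (tau lam f j) j =2 f.
Proof.
have E : tau_row (tau lam f j) = tau_row f.
  rewrite /tau_row; congr maxn; rewrite [LHS]big_nat_cond [RHS]big_nat_cond.
  apply: eq_bigl => r; case: (boolP (2 <= r < h.+1)) => //= hr.
  by rewrite tau_stop_tau.
move=> i k; rewrite (tauE (tau lam f j)) E.
case: ifP => hi; last by rewrite tauE hi.
have [e1 e2] := tau_hi hi; rewrite e1 e2.
case: eqP => [->//|/eqP kj]; case: eqP => [->//|/eqP kj1].
by rewrite tau_off.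
Qed.

Lemma valid_tau n f : valid lam n f -> valid lam n (tau lam f j).
Proof.
move=> vf i k; case: (eqVneq k j) => [->|kj].
  case: (tau_perm f i) => [] [-> _]; first exact: vf.
  by have := vf i j.+1; rewrite /in_dg hgtS j_gt0.
case: (eqVneq k j.+1) => [->|kj1]; last by rewrite tau_off.
case: (tau_perm f i) => [] [_ ->]; first exact: vf.
by have := vf i j; rewrite /in_dg hgtS j_gt0.
Qed.

Lemma j_lt_size : j < L.
Proof. by apply: (hgt_pos_size (c := j.+1)); rewrite hgtS. Qed.

(** Pairs with a column to the left are merely permuted. For a column to the right only the row
    below the lowest swapped one needs [inQ_exchange]. Between the two columns themselves only the
    top row changes, where 0 above turns [inQ] into a plain comparison. *)
Lemma tau_quinvr n f : valid lam n f ->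
  quinvr lam (tau lam f j) + (f h j < f h j.+1) = quinvr lam f + (f h j.+1 < f h j).
Proof.
move=> vf; have jL : 0 < j < L by rewrite j_gt0 j_lt_size.
have [hm stop go] := tau_rowP f.
rewrite /quinvr !(pairsum_split2 _ jL).
have off i k : k != j -> k != j.+1 -> tau lam f j i k = f i k by exact: tau_off.
have E i k : i != j -> i != j.+1 -> k != j -> k != j.+1 -> colq lam (tau lam f j) i k = colq lam f i k.
  by move=> ? ? ? ?; apply: eq_big_nat => r _; rewrite !off.
set X := (X in _ + X + _ = _); set Y := (Y in _ = _ + Y + _).
have -> : X = Y.
  rewrite /X /Y; congr (_ + _).
    by apply: eq_big_nat => i ?; congr (_ + _); apply: eq_big_nat => k ?; apply: E; lia.
  by apply: eq_big_nat => i ?; apply: eq_big_nat => k ?; apply: E; lia.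
have -> : \sum_(1 <= i < j) (colq lam (tau lam f j) i j + colq lam (tau lam f j) i j.+1) =
          \sum_(1 <= i < j) (colq lam f i j + colq lam f i j.+1).
  apply: eq_big_nat => i hi; rewrite /colq hgtS -!big_split /=.
  apply: eq_big_nat => r _; have offi r' : tau lam f j r' i = f r' i by apply: off; lia.
  rewrite !offi.
  by case: (tau_perm f r) => [] [-> ->] //; rewrite addnC.
have -> : \sum_(j.+2 <= k < L.+1) (colq lam (tau lam f j) j k + colq lam (tau lam f j) j.+1 k) =
          \sum_(j.+2 <= k < L.+1) (colq lam f j k + colq lam f j.+1 k).
  apply: eq_big_nat => k hk; rewrite /colq -!big_split /=.
  have hkj : hgt k <= h by apply: hgt_mono; lia.
  apply: eq_big_nat => r hr; have offk r' : tau lam f j r' k = f r' k by apply: off; lia.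
  rewrite !offk.
  have [lt|[eq|gt]] : r.+1 < tau_row f \/ r.+1 = tau_row f \/ tau_row f <= r by lia.
  - by rewrite !tau_lo //; lia.
  - have [|-> ->] := @tau_hi f r.+1; [lia|].
    have lo k' : tau lam f j r k' = f r k' by apply: tau_lo; lia.
    rewrite !lo.
    symmetry; apply: inQ_exchange.
    by move: stop; rewrite -eq /tau_stop /= => st; apply/eqP/st; lia.
  - have [|-> ->] := @tau_hi f r; [lia|].
    case: (ltnP r h) => rh.
      by have [|-> ->] := @tau_hi f r.+1; [lia|rewrite addnC].
    have out g c : valid lam n g -> c = j \/ c = j.+1 -> g r.+1 c = 0.
      by move=> vg cj; apply: (valid_out vg); case: cj => ->; rewrite /in_dg ?hgtS; lia.
    have vf' := valid_tau vf.
    by rewrite !(out _ j) ?(out _ j.+1) 1?addnC //; [right | right | left | left].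
suff : colq lam (tau lam f j) j j.+1 + (f h j < f h j.+1) = colq lam f j j.+1 + (f h j.+1 < f h j) by lia.
rewrite /colq hgtS !(@big_nat_recr _ _ _ h) //=.
have -> : \sum_(1 <= r < h) (inQ (tau lam f j r.+1 j) (tau lam f j r j) (tau lam f j r j.+1) : nat) =
          \sum_(1 <= r < h) (inQ (f r.+1 j) (f r j) (f r j.+1) : nat).
  apply: eq_big_nat => r hr.
  have [lt|[eq|gt]] : r.+1 < tau_row f \/ r.+1 = tau_row f \/ tau_row f <= r by lia.
  - by rewrite !tau_lo //; lia.
  - have [|-> _] := @tau_hi f r.+1; [lia|].
    have lo k' : tau lam f j r k' = f r k' by apply: tau_lo; lia.
    rewrite !lo.
    have -> // : inQ (f r.+1 j) (f r j) (f r j.+1) = inQ (f r.+1 j.+1) (f r j) (f r j.+1).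
    by move: stop; rewrite -eq /tau_stop /= => st; apply/eqP/st; lia.
  (* Both rows are swapped. Since [tau_stop] fails in row r + 1, exactly one upper entry lies on the
     arc if the lower entries differ; exchanging the upper entries and complementing the arc
     cancel. *)
  - have [|-> ->] := @tau_hi f r; [lia|].
    have [|-> _] := @tau_hi f r.+1; [lia|].
    have := go r.+1; rewrite /tau_stop /=.
    case: (eqVneq (f r j) (f r j.+1)) => [->|ne]; first by rewrite !inQ_diag.
    rewrite !(inQ_swap _ ne); case: inQ; case: inQ => //=; lia.
have top g : valid lam n g -> g h.+1 j = 0.
  by move=> vg; apply: (valid_out vg); rewrite /in_dg; lia.
rewrite (top _ vf) (top _ (valid_tau vf)).
have [-> ->] := tau_top f; rewrite !inQ0.
have := @valid_in lam n f h j vf; have := @valid_in lam n f h j.+1 vf.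
rewrite /in_dg hgtS; lia.
Qed.

Lemma tau_prod (T : Type) (idx : T) (op : Monoid.com_law idx) (x : nat -> T) f :
  \big[op/idx]_(1 <= c < L.+1) \big[op/idx]_(1 <= r < (hgt c).+1) x (tau lam f j r c) =
  \big[op/idx]_(1 <= c < L.+1) \big[op/idx]_(1 <= r < (hgt c).+1) x (f r c).
Proof.
have jL := j_lt_size.
rewrite !(@big_cat_nat _ _ _ j 1 L.+1) //=; try lia.
rewrite !(@big_ltn _ _ _ j L.+1); try lia.
rewrite !(@big_ltn _ _ _ j.+1 L.+1); try lia.
have E c : c != j -> c != j.+1 ->
   \big[op/idx]_(1 <= r < (hgt c).+1) x (tau lam f j r c) =
   \big[op/idx]_(1 <= r < (hgt c).+1) x (f r c).
  by move=> ? ?; apply: eq_big_nat => r _; rewrite tau_off.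
congr (op _ _); first by apply: eq_big_nat => c ?; apply: E; lia.
rewrite !Monoid.mulmA; congr (op _ _); last by apply: eq_big_nat => c ?; apply: E; lia.
rewrite hgtS; have sp := @big_split _ idx op _ (index_iota 1 h.+1) xpredT.
rewrite -[LHS]sp -[RHS]sp; apply: eq_big_nat => r _.
by case: (tau_perm f r) => [] [-> ->] //; rewrite Monoid.mulmC.
Qed.

(** The distinguished entry 1 moves one column to the right. If the other top entry is not 1,
    [quinvr] drops by one; if it is 1, it leaves the arm of the cell above. The total drops by one
    either way. *)
Lemma tau_right n f : valid lam n f -> f h j = 1 ->
  tau lam f j h j.+1 = 1 /\
  quinvr lam (tau lam f j) + armc lam (tau lam f j) 1 h.+1 j.+1 + 1 =
  quinvr lam f + armc lam f 1 h.+1 j.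
Proof.
move=> vf f1; have [e1 e2] := tau_top f; split; first by rewrite e2.
have := tau_quinvr vf; rewrite f1 /armc.
have jL := j_lt_size.
rewrite big_nat_recr //= (@big_ltn _ _ _ j.+1 L.+1) //.
have -> : tau lam f j h.+1 j = 0.
  by apply: (valid_out (valid_tau vf)); rewrite /in_dg; lia.
have -> : \sum_(1 <= i < j) (tau lam f j h.+1 i == 1 : nat) =
          \sum_(1 <= i < j) (f h.+1 i == 1 : nat).
  by apply: eq_big_nat => i hi; rewrite tau_off //; lia.
have -> : \sum_(j.+2 <= i < L.+1) (tau lam f j h i == 1 : nat) =
          \sum_(j.+2 <= i < L.+1) (f h i == 1 : nat).
  by apply: eq_big_nat => i hi; rewrite tau_off //; lia.
have := @valid_in lam n f h j.+1 vf; rewrite /in_dg hgtS.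
lia.
Qed.

Lemma quinvr_ext f g : f =2 g -> quinvr lam f = quinvr lam g.
Proof.
move=> fg; apply: eq_big_nat => i _; apply: eq_big_nat => k _.
by apply: eq_big_nat => r _; rewrite !fg.
Qed.

Lemma armc_ext f g a r c : f =2 g -> armc lam f a r c = armc lam g a r c.
Proof. by move=> fg; congr (_ + _); apply: eq_big_nat => i _; rewrite fg. Qed.

(** As [tau] is an involution, this is [tau_right] read backwards. *)
Lemma tau_left n f : valid lam n f -> f h j.+1 = 1 ->
  tau lam f j h j = 1 /\
  quinvr lam (tau lam f j) + armc lam (tau lam f j) 1 h.+1 j =
  quinvr lam f + armc lam f 1 h.+1 j.+1 + 1.
Proof.
move=> vf f1; have [e1 e2] := tau_top f; split; first by rewrite e1.
have [|_ <-] := tau_right (valid_tau vf); first by rewrite e1.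
by rewrite (quinvr_ext (tauK f)) (armc_ext _ _ _ (tauK f)).
Qed.

End Tau.

(** * The map R' *)

(** Equal parts are consecutive in a sorted list; h > 0 rules out the default value of [nth] beyond
    its end. *)
Lemma sorted_geq_nthE l i h : sorted geq l -> 0 < h ->
  (nth 0 l i == h) = (index h l <= i < index h l + count_mem h l).
Proof.
move=> + h0; elim: l i => [|a l ih] i /=; first by rewrite nth_nil; lia.
move=> sal; have sl : sorted geq l := path_sorted sal.
case: (eqVneq a h) => [ah|ah]; last first.
  by case: i => [|i] /=; [rewrite (negbTE ah) | rewrite ih // !ltnS].
case: i => [|i] /=; first by rewrite ah eqxx.
rewrite ih //; case: l sal {sl ih} => [|b l] /= sal; first by lia.
case: (eqVneq b h) => bh /=; first by lia.
suff -> : count_mem h l = 0 by lia.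
apply/eqP; rewrite eqn0Ngt -has_count; apply/hasPn => y yl /=.
have : sorted geq (b :: l) by case/andP: sal.
rewrite /= path_sortedE; last by move=> ? ? ? /=; lia.
by move=> /andP[/allP /(_ _ yl) /= yb _]; move: sal; rewrite ah; lia.
Qed.

(** The summand n keeps the subtraction from being truncated. The case n = 1 is separate because 1
    is then 0 modulo n. *)
Lemma path_step_mod n a b : 0 < a <= n -> 0 < b <= n ->
  (b + n - a == 1 %[mod n]) = (b == incr n a).
Proof.
move=> ha hb; rewrite incrE //.
case: (eqVneq n 1) => [n1|n1].
  have -> : a = 1 by lia.
  have -> : b = 1 by lia.
  by rewrite n1 !modn1.
rewrite (@modn_small 1) //; last by lia.
case: (leqP a b) => ab.
  have -> : b + n - a = (b - a) + n by lia.
  by rewrite modnDr modn_small; [case: (eqVneq a n) => ?; lia | lia].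
by rewrite modn_small; [case: (eqVneq a n) => ?; lia | lia].
Qed.

Lemma lamc_mono lam : sorted geq lam ->
  forall i j, 0 < i <= j -> lamc lam j <= lamc lam i.
Proof.
move=> lam_sorted i j ij; rewrite /lamc.
case: (ltnP j.-1 (size lam)) => jL; last by rewrite nth_default.
have := sorted_leq_nth _ _ 0 lam_sorted; apply => //.
- by move=> ? ? ? /=; lia.
- by move=> ?; apply: leqnn.
- by rewrite inE; lia.
- by lia.
Qed.

Section Rprime.
Variables (lam : seq nat) (n : nat).
Local Notation hgt := (lamc lam).
Local Notation L := (size lam).
Hypothesis lam_sorted : sorted geq lam.
Hypothesis n_gt0 : 0 < n.

Definition dgprod (T : Type) (idx : T) (op : Monoid.com_law idx) (x : nat -> T) (f : rawfill) :=
  \big[op/idx]_(1 <= c < L.+1) \big[op/idx]_(1 <= r < (hgt c).+1) x (f r c).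

Lemma ringhP f r c : valid lam n f -> in_dg lam r c ->
  let h := ringh lam n f r c in
  [/\ r <= h <= hgt c, forall i, r <= i < h -> f i.+1 c = incr n (f i c) &
      h < hgt c -> f h.+1 c <> incr n (f h c)].
Proof.
move=> vf dgr; rewrite /ringh.
pose P h := all (fun i => f i.+1 c + n - f i c == 1 %[mod n]) (iota r (h - r)).
rewrite -[\max_(_ <= _ < _ | _) _]/(\max_(r <= h < (hgt c).+1 | P h) h).
have [maxh] := bigmax_nat_spec r (hgt c).+1 P.
set h := (\max_(_ <= _ < _ | _) _) in maxh *.
clearbody h; cbv zeta.
have [c0 /andP[r0 rc]] : 0 < c /\ 0 < r <= hgt c by move: dgr; rewrite /in_dg; lia.
have Pr : P r by rewrite /P subnn.
have stepE i : r <= i < hgt c -> (f i.+1 c + n - f i c == 1 %[mod n]) = (f i.+1 c == incr n (f i c)).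
  by move=> hi; apply: path_step_mod; apply: (valid_in vf); rewrite /in_dg; lia.
case=> [h0|/andP[hh Ph]]; first by have := maxh r _ Pr; lia.
have path i : r <= i < h -> f i.+1 c = incr n (f i c).
  move=> hi; apply/eqP; rewrite -stepE; last by lia.
  by move/allP: Ph; apply; rewrite mem_iota; lia.
split=> //.
move=> hc E; have : P h.+1; last by move=> /(maxh h.+1); lia.
apply/allP => i; rewrite mem_iota => hi.
rewrite stepE; last by lia.
by case: (eqVneq i h) => [->|ih]; [rewrite E | rewrite path //; lia].
Qed.

(** Along the path the new entries are the old ones shifted down by one row: [f r v] leaves the
    content and [incr n (f h v)] enters it. *)
Lemma dgprod_ring (T : Type) (idx : T) (op : Monoid.com_law idx) (x : nat -> T) f r v h :
  0 < r <= h -> h <= hgt v -> 0 < v ->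
  (forall i, r <= i < h -> f i.+1 v = incr n (f i v)) ->
  op (dgprod op x (ring n f v r h)) (x (f r v)) =
  op (dgprod op x f) (x (incr n (f h v))).
Proof.
move=> rh hv v0 path.
have vL : v <= L by apply: hgt_pos_size; lia.
rewrite /dgprod !(@big_cat_nat _ _ _ v 1 L.+1) //=; try lia.
rewrite !(@big_ltn _ _ _ v L.+1); try lia.
rewrite !(@big_cat_nat _ _ _ r 1 (hgt v).+1) //=; try lia.
rewrite !(@big_cat_nat _ _ _ h.+1 r (hgt v).+1) //=; try lia.
pose D i := x (if i <= h then f i v else incr n (f h v)).
have E c : c != v -> \big[op/idx]_(1 <= r0 < (hgt c).+1) x (ring n f v r h r0 c) =
   \big[op/idx]_(1 <= r0 < (hgt c).+1) x (f r0 c).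
  by move=> cv; apply: eq_big_nat => i _; rewrite ringE (negbTE cv).
set A := \big[op/idx]_(1 <= i < v) _; set A' := \big[op/idx]_(1 <= i < v) _.
have -> : A = A' by apply: eq_big_nat => i ?; apply: E; lia.
set B := \big[op/idx]_(v.+1 <= i < _) _; set B' := \big[op/idx]_(v.+1 <= i < _) _.
have -> : B = B' by apply: eq_big_nat => i ?; apply: E; lia.
set C := \big[op/idx]_(1 <= i < r) _; set C' := \big[op/idx]_(1 <= i < r) _.
have -> : C = C'.
  apply: eq_big_nat => i ?; rewrite ringE.
  by have -> : (r <= i <= h) = false; [lia | rewrite andbF].
set K := \big[op/idx]_(h.+1 <= i < _) _; set K' := \big[op/idx]_(h.+1 <= i < _) _.
have -> : K = K'.
  apply: eq_big_nat => i ?; rewrite ringE.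
  by have -> : (r <= i <= h) = false; [lia | rewrite andbF].
set M := \big[op/idx]_(r <= i < _) _; set M' := \big[op/idx]_(r <= i < _) _.
have rh' : r <= h.+1 by lia.
have := @big_nat_shift _ idx op r h D rh'.
have -> : \big[op/idx]_(r <= i < h.+1) D i.+1 = M.
  apply: eq_big_nat => i ri; rewrite ringE eqxx (_ : (r <= i <= h) = true) /=; last by lia.
  rewrite /D; case: ltnP => ih; first by rewrite path //; lia.
  by have -> : i = h by lia.
have -> : \big[op/idx]_(r <= i < h.+1) D i = M'.
  by apply: eq_big_nat => i ri; rewrite /D; have -> : i <= h by lia.
rewrite /D ltnn; have -> : r <= h by lia.
move=> MM.
have key y z : op (op A' (op (op C' (op y K')) B')) z =
               op A' (op (op C' (op (op y z) K')) B').
  rewrite -[LHS]Monoid.mulmA; congr (op A' _); rewrite [LHS]Monoid.mulmAC.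
  congr (op _ B'); rewrite -[LHS]Monoid.mulmA; congr (op C' _); exact: Monoid.mulmAC.
by rewrite !key MM.
Qed.

(** * Chains of operators tau across a block of columns of equal height *)

Local Notation taus f s := (foldl (fun g j => tau lam g j) f s).

Definition twin j := [&& 0 < j, 0 < hgt j & hgt j.+1 == hgt j].

Lemma valid_taus s f : all twin s -> valid lam n f -> valid lam n (taus f s).
Proof.
elim: s f => //= j s ih f /andP[/and3P[j0 h0 /eqP e] ts] vf.
by apply: ih => //; apply: valid_tau.
Qed.

Lemma dgprod_taus (T : Type) (idx : T) (op : Monoid.com_law idx) (x : nat -> T) s f :
  all twin s -> dgprod op x (taus f s) = dgprod op x f.
Proof.
elim: s f => //= j s ih f /andP[/and3P[j0 h0 /eqP e] ts].
by rewrite ih // /dgprod tau_prod.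
Qed.

Lemma taus_inj s f g : all twin s -> taus f s =2 taus g s -> f =2 g.
Proof.
elim: s f g => //= j s ih f g /andP[/and3P[j0 h0 /eqP e] ts] /(ih _ _ ts) E.
by move=> i k; rewrite -(tauK j0 h0 e f) (tau_ext lam j E) tauK.
Qed.

Lemma taus_right f v m : 0 < v -> 0 < hgt v -> (forall i, i <= m -> hgt (v + i) = hgt v) ->
  valid lam n f -> f (hgt v) v = 1 ->
  let g := taus f (iota v m) in
  g (hgt v) (v + m) = 1 /\
  quinvr lam g + armc lam g 1 (hgt v).+1 (v + m) + m =
  quinvr lam f + armc lam f 1 (hgt v).+1 v.
Proof.
elim: m v f => [|m ih] v f v0 h0 hh vf f1 /=; first by rewrite !addn0.
have hS : hgt v.+1 = hgt v by rewrite -addn1 hh.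
have [t1 t2] := tau_right (lamc_mono lam_sorted) v0 h0 hS vf f1.
have := ih v.+1 (tau lam f v); rewrite hS addSnnS => -[] //.
- by move=> i im; rewrite addSnnS hh.
- exact: valid_tau.
by move=> -> e; split=> //; lia.
Qed.

Lemma taus_left f v m : 0 < v -> 0 < hgt v -> (forall i, i <= m -> hgt (v + i) = hgt v) ->
  valid lam n f -> f (hgt v) (v + m) = 1 ->
  let g := taus f (rev (iota v m)) in
  g (hgt v) v = 1 /\
  quinvr lam g + armc lam g 1 (hgt v).+1 v =
  quinvr lam f + armc lam f 1 (hgt v).+1 (v + m) + m.
Proof.
elim: m f => [|m ih] f v0 h0 hh vf f1; first by rewrite /= !addn0 in f1 *.
(* In decreasing order the rightmost pair is swapped first, so the entry 1 travels left from column
   v + m. *)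
have -> : iota v m.+1 = rcons (iota v m) (v + m) by rewrite -addn1 iotaD cats1.
rewrite rev_rcons /=.
have hS : hgt (v + m).+1 = hgt (v + m) by rewrite -addnS !hh.
have hm : hgt (v + m) = hgt v by rewrite hh.
have vm0 : 0 < v + m by lia.
have hm0 : 0 < hgt (v + m) by rewrite hm.
have f1' : f (hgt (v + m)) (v + m).+1 = 1 by rewrite hm -addnS.
have [t1 t2] := tau_left (lamc_mono lam_sorted) vm0 hm0 hS vf f1'.
rewrite hm in t1 t2.
have [] := ih (tau lam f (v + m)) => //.
- by move=> i im; rewrite hh //; lia.
- exact: valid_tau.
by move=> -> e; split=> //; rewrite e t2 -addnS; lia.
Qed.

(** The reflection 2s + k - v of the block of columns s, ..., s + k of the height of v; [index]
    counts from 0, whence the successor. *)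
Definition mirror v :=
  2 * (index (hgt v) lam).+1 + (count_mem (hgt v) lam).-1 - v.

Definition turn f r v :=
  let h := ringh lam n f r v in (f h v == n) && (h == hgt v).

Definition tcol f r v := if turn f r v then mirror v else v.

Lemma block v j : 0 < hgt v -> 0 < j -> 0 < v ->
  (hgt j == hgt v) = ((index (hgt v) lam).+1 <= j <=
       (index (hgt v) lam).+1 + (count_mem (hgt v) lam).-1).
Proof.
move=> h0 j0 v0; rewrite {1}/lamc sorted_geq_nthE //.
have : 0 < count_mem (hgt v) lam.
  have := sorted_geq_nthE v.-1 lam_sorted h0; rewrite -/(hgt v) eqxx; lia.
by move: (count_mem _ _) (index _ _) => a b; lia.
Qed.

Lemma mirrorP v : 0 < v -> 0 < hgt v ->
  [/\ 0 < mirror v, hgt (mirror v) = hgt v, mirror (mirror v) = v &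
      forall j, minn v (mirror v) <= j <= maxn v (mirror v) -> hgt j = hgt v].
Proof.
move=> v0 h0; have B := fun j h => @block v j h0 h v0.
have := B v v0; rewrite eqxx => /esym bv.
have m0 : 0 < mirror v by rewrite /mirror; lia.
have hm : hgt (mirror v) = hgt v by apply/eqP; rewrite B // /mirror; lia.
split=> //; first by rewrite {1}/mirror hm /mirror; lia.
by move=> j hj; apply/eqP; rewrite B; move: hj; rewrite /mirror; lia.
Qed.

Lemma sum_nat_itv a b s e : a <= s -> s <= e -> e <= b ->
  \sum_(a <= j < b) (s <= j < e : nat) = e - s.
Proof.
move=> h1 h2 h3; rewrite (@big_cat_nat _ _ _ s) //=; last by lia.
rewrite (@big_cat_nat _ _ _ e s) //= !big_nat.
rewrite big1 => [|i ?]; last by lia.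
rewrite [X in _ + (_ + X)]big1 => [|i ?]; last by lia.
rewrite (eq_bigr (fun=> 1)) => [|i ?]; last by lia.
by rewrite -big_nat sum_nat_const_nat; lia.
Qed.

(** In the block s, ..., s + k the two counts are s + k - v and v - s. Their difference is
    [mirror v] minus v, which is the signed number of operators [tau] applied. *)
Lemma block_counts v : 0 < v -> 0 < hgt v ->
  \sum_(v.+1 <= j < L.+1) (hgt v <= hgt j : nat) + v =
  \sum_(1 <= j < v) (hgt j == hgt v : nat) + mirror v.
Proof.
move=> v0 h0; have B := fun j h => @block v j h0 h v0.
have := B v v0; rewrite eqxx => /esym bv.
set s := (index _ _).+1 in B bv; set k := (count_mem _ _).-1 in B bv.
have -> : \sum_(v.+1 <= j < L.+1) (hgt v <= hgt j : nat) =
          \sum_(v.+1 <= j < L.+1) (v.+1 <= j < (s + k).+1 : nat).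
  apply: eq_big_nat => j hj; have := B j; have := @lamc_mono lam lam_sorted v j; lia.
have -> : \sum_(1 <= j < v) (hgt j == hgt v : nat) =
          \sum_(1 <= j < v) (s <= j < v : nat).
  by apply: eq_big_nat => j hj; rewrite B //; lia.
have skL : s + k <= L.
  apply: hgt_pos_size; have : hgt (s + k) == hgt v by rewrite B //; lia.
  by lia.
rewrite !sum_nat_itv //; try lia.
by rewrite /mirror -/s -/k; lia.
Qed.

Lemma RprimeE f r v : let h := ringh lam n f r v in let g := ring n f v r h in
  h <= hgt v ->
  Rprime lam n f r v = if turn f r v then
    if v <= mirror v then taus g (iota v (mirror v - v))
    else taus g (rev (iota (mirror v) (v - mirror v))) else g.
Proof.
move=> h g hv; rewrite /Rprime /turn -/h.
by have -> : (f h v == n) && (h == hgt v) = ~~ ((f h v != n) || (h < hgt v));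
  [lia | case: ifP].
Qed.

Lemma twin_itv a m : 0 < a -> 0 < hgt a -> (forall i, i <= m -> hgt (a + i) = hgt a) ->
  all twin (iota a m).
Proof.
move=> a0 h0 hh; apply/allP => j; rewrite mem_iota /twin => hj.
have e1 := hh (j - a); have e2 := hh (j.+1 - a).
by rewrite !subnKC in e1 e2; lia.
Qed.

Section Spec.
Variables (f : rawfill) (r v : nat).
Hypotheses (vf : valid lam n f) (dgu : in_dg lam r v) (sok : south_ok f r v).
Let h := ringh lam n f r v.
Let g := Rprime lam n f r v.
Let w := tcol f r v.

Lemma twin_turn : all twin (if v <= mirror v then iota v (mirror v - v)
                            else rev (iota (mirror v) (v - mirror v))).
Proof.
have [v0 hv0] : 0 < v /\ 0 < hgt v by move: dgu; rewrite /in_dg; lia.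
have [m0 hm mm itv] := mirrorP v0 hv0.
case: leqP => vm; rewrite ?all_rev; apply: twin_itv => //; rewrite ?hm // => i hi;
 apply: itv; lia.
Qed.

(** Without a turn this is [quinvr_ring]. With a turn, [block_counts] evaluates the excess left by
    ringing as [mirror v] minus v, and the chain of [tau] removes it one unit per step. *)
Lemma Rprime_spec :
  [/\ valid lam n g, in_dg lam h w, g h w = incr n (f h v),
      g h.+1 w <> g h w &
      quinvr lam g + armc lam g (g h w) h.+1 w =
      quinvr lam f + armc lam f (f r v) r v].
Proof.
have [v0 r0] : 0 < v /\ 0 < r <= hgt v by move: dgu; rewrite /in_dg; lia.
have hv0 : 0 < hgt v by lia.
have [hh path stop] := ringhP vf dgu; rewrite -/h in hh path stop.
have [m0 hm mm itv] := mirrorP v0 hv0.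
have vr : valid lam n (ring n f v r h) by apply: valid_ring => //; lia.
have hr : r <= h by lia.
have hv : h <= hgt v by lia.
have r1 : 0 < r by lia.
have fhv : 0 < f h v <= n by apply: (valid_in vf); rewrite /in_dg; lia.
have Q := quinvr_ring (lamc_mono lam_sorted) n_gt0 vf v0 r1 hr hv sok path stop.
have gv : ring n f v r h h v = incr n (f h v) by rewrite ringE eqxx hr leqnn.
rewrite /g RprimeE // /w /tcol -/h; case: (boolP (turn f r v)) => tu; last first.
  split=> //.
  - by rewrite /in_dg; lia.
  - rewrite gv ringE ltnn andbF andbF; case: (ltnP h (hgt v)) => hhv; first exact: stop.
    rewrite (valid_out vf); last by rewrite /in_dg; lia.
    by have := incr_range (f h v) n_gt0; lia.
  - by move: tu Q; rewrite /turn -/h andbC => /negbTE->; rewrite !mul0n !addn0.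
have [/eqP fn /eqP hE] := andP tu; rewrite -/h in fn hE.
move: Q; rewrite gv fn -hE !eqxx !mul1n => Q.
have one : incr n n = 1 by rewrite incrE ?eqxx //; lia.
rewrite one -?hE in Q *.
have C := block_counts v0 hv0; rewrite -hE in C.
have dgw : in_dg lam h (mirror v) by rewrite /in_dg; lia.
have up gg : valid lam n gg -> gg h.+1 (mirror v) = 0.
  by move=> vg; apply: (valid_out vg); rewrite /in_dg; lia.
have gv1 : ring n f v r h h v = 1 by rewrite gv fn.
have tw := twin_turn.
have [vm|vm] : v <= mirror v \/ mirror v < v by lia.
  rewrite vm in tw *.
  have vg := valid_taus tw vr.
  have [||] := @taus_right (ring n f v r h) v (mirror v - v) v0 hv0 _ vr.
  - by move=> i hi; apply: itv; lia.
  - by rewrite -hE.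
  rewrite -hE subnKC // => e1 e2.
  split=> //; rewrite ?e1 //; first by rewrite up.
  lia.
rewrite leqNgt vm /= in tw *.
have vg := valid_taus tw vr.
have [|||] := @taus_left (ring n f v r h) (mirror v) (v - mirror v) m0 _ _ vr.
- by rewrite hm.
- by move=> i hi; rewrite hm; apply: itv; lia.
- by rewrite hm subnKC -?hE //; lia.
rewrite hm -hE subnKC ?(ltnW vm) // => e1 e2.
split=> //; rewrite ?e1 //; first by rewrite up.
lia.
Qed.

Lemma dgprod_Rprime (T : Type) (idx : T) (op : Monoid.com_law idx) (x : nat -> T) :
  op (dgprod op x g) (x (f r v)) = op (dgprod op x f) (x (g h w)).
Proof.
have [v0 r0] : 0 < v /\ 0 < r <= hgt v by move: dgu; rewrite /in_dg; lia.
have [hh path _] := ringhP vf dgu; rewrite -/h in hh path.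
have [_ _ -> _ _] := Rprime_spec.
rewrite -(dgprod_ring op x (r := r)) //; try lia.
congr (op _ _); rewrite /g RprimeE -/h; last by lia.
case: (turn f r v) => //; have := twin_turn.
by case: ifP => _ tw; rewrite dgprod_taus.
Qed.

(** Injectivity requires that the new filling and the distinguished cell reveal whether [tau] was
    applied: a wrap at the top of a column leaves a 1 there. *)
Lemma turnE : turn f r v = (h == hgt w) && (g h w == 1).
Proof.
have [v0 r0] : 0 < v /\ 0 < r <= hgt v by move: dgu; rewrite /in_dg; lia.
have hv0 : 0 < hgt v by lia.
have [hh path stop] := ringhP vf dgu; rewrite -/h in hh path stop.
have [_ hm _ _] := mirrorP v0 hv0.
have [_ _ -> _ _] := Rprime_spec.
have -> : hgt w = hgt v by rewrite /w /tcol; case: ifP.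
have fhv : 0 < f h v <= n by apply: (valid_in vf); rewrite /in_dg; lia.
by rewrite /turn -/h incrE //; case: eqP => _; lia.
Qed.

End Spec.

(* The bottom of the path can be read off the new filling: it is the first place,
   going down from [h], where the entries stop decreasing cyclically by one. *)
Lemma ring_inj f1 f2 v r1 r2 h : valid lam n f1 -> valid lam n f2 ->
  0 < v -> 0 < r1 <= h -> 0 < r2 <= h -> h <= hgt v ->
  (forall i, r1 <= i < h -> f1 i.+1 v = incr n (f1 i v)) ->
  south_ok f2 r2 v ->
  ring n f1 v r1 h =2 ring n f2 v r2 h -> r2 <= r1.
Proof.
move=> vf1 vf2 v0 hr1 hr2 hv path sok E; rewrite leqNgt; apply/negP => r12.
have in1 i : 0 < i <= h -> 0 < f1 i v <= n.
  by move=> hi; apply: (valid_in vf1); rewrite /in_dg; lia.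
have in2 i : 0 < i <= h -> 0 < f2 i v <= n.
  by move=> hi; apply: (valid_in vf2); rewrite /in_dg; lia.
(* If r1 < r2, only the first path contains row r2 - 1. So [f2] has there the value
   [incr n (f1 r2.-1 v)], which is [f1 r2 v] and hence [f2 r2 v], against [south_ok]. *)
have := E r2 v; have := E r2.-1 v; rewrite !ringE eqxx /=.
have -> : (r1 <= r2.-1 <= h) = true by lia.
have -> : (r2 <= r2.-1 <= h) = false by lia.
have -> : (r1 <= r2 <= h) = true by lia.
have -> : (r2 <= r2 <= h) = true by lia.
have -> : f1 r2 v = incr n (f1 r2.-1 v).
  by rewrite -path; [congr (f1 _ v); lia | lia].
move=> -> /incr_inj e; move: sok; rewrite /south_ok e ?eqxx; try apply: in2; lia.
Qed.

(** The map is undone in stages: [turnE] tells whether [tau] acted, the involution [mirror] gives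
    back the column, [taus_inj] the rung filling, [ring_inj] used both ways the starting row, and
    [incr_inj] the entries. *)
Lemma Rprime_inj f1 f2 r1 v1 r2 v2 : valid lam n f1 -> valid lam n f2 ->
  in_dg lam r1 v1 -> in_dg lam r2 v2 -> south_ok f1 r1 v1 -> south_ok f2 r2 v2 ->
  Rprime lam n f1 r1 v1 =2 Rprime lam n f2 r2 v2 ->
  ringh lam n f1 r1 v1 = ringh lam n f2 r2 v2 ->
  tcol f1 r1 v1 = tcol f2 r2 v2 ->
  [/\ f1 =2 f2, r1 = r2 & v1 = v2].
Proof.
move=> vf1 vf2 dg1 dg2 s1 s2 E eh ew.
have tE : turn f1 r1 v1 = turn f2 r2 v2 by rewrite !turnE // E eh ew.
have [v10 r10] : 0 < v1 /\ 0 < r1 <= hgt v1 by move: dg1; rewrite /in_dg; lia.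
have [v20 r20] : 0 < v2 /\ 0 < r2 <= hgt v2 by move: dg2; rewrite /in_dg; lia.
have ev : v1 = v2.
  move: ew; rewrite /tcol -tE; case: ifP => // tu e.
  have [_ _ <- _] := @mirrorP v1 v10 ltac:(lia); rewrite e.
  by have [_ _ -> _] := @mirrorP v2 v20 ltac:(lia).
rewrite -{}ev in dg2 s2 E eh ew tE r20 *.
have [h1 p1 _] := ringhP vf1 dg1; have [h2 p2 _] := ringhP vf2 dg2.
rewrite -eh in h2 p2; set h := ringh _ _ _ _ _ in eh h1 p1 h2 p2.
have ER : ring n f1 v1 r1 h =2 ring n f2 v1 r2 h.
  move: E; rewrite !RprimeE -?eh -/h -?tE; try lia.
  case: ifP => // _; have tw := twin_turn dg1 s1.
  by move: tw; case: ifP => _ tw /(taus_inj tw).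
have er : r1 = r2.
  have ER' : ring n f2 v1 r2 h =2 ring n f1 v1 r1 h by move=> i j; rewrite ER.
  have r1h : 0 < r1 <= h by lia.
  have r2h : 0 < r2 <= h by lia.
  have hv1 : h <= hgt v1 by lia.
  have := ring_inj vf1 vf2 v10 r1h r2h hv1 p1 s2 ER.
  have := ring_inj vf2 vf1 v10 r2h r1h hv1 p2 s1 ER'.
  by lia.
split=> // i j; have := ER i j; rewrite !ringE -er.
case: (boolP ((j == v1) && _)) => // /andP[/eqP-> hi].
by apply: incr_inj; apply: valid_in; rewrite // /in_dg; lia.
Qed.

End Rprime.

(** * Tableaux and global balance *)

Lemma sum_pairE (V : nmodType) (I J : finType) (F : I * J -> V) :
  (\sum_p F p = \sum_i \sum_j F (i, j))%R.
Proof. by rewrite pair_bigA /=; apply: eq_bigr => -[]. Qed.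

Section Tableaux.
Variables (lam : seq nat) (n : nat).
Local Notation hgt := (lamc lam).
Local Notation L := (size lam).
Implicit Types (s : Tab lam n) (u : cell lam).

Lemma cell_in_dg u : in_dg lam (rowc u) (colc u).
Proof. by rewrite /in_dg /lamc /=; exact: (valP u). Qed.

Lemma cell_inj u v : rowc u = rowc v -> colc u = colc v -> u = v.
Proof.
move=> [er] [ec]; apply: val_inj.
by rewrite [val u]surjective_pairing [val v]surjective_pairing;
  congr pair; apply: val_inj.
Qed.

Lemma nth_le_foldr_maxn (l : seq nat) i : nth 0 l i <= foldr maxn 0 l.
Proof.
elim: l i => [|a l ih] [|i] //=; first exact: leq_maxl.
exact: leq_trans (ih i) (leq_maxr _ _).
Qed.

Lemma cell_exists r c : in_dg lam r c -> exists u, rowc u = r /\ colc u = c.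
Proof.
case/and3P => c0 r0 rc; have cL := hgt_pos_size (leq_trans r0 rc).
have cL' : c.-1 < L by lia.
have rH : r.-1 < foldr maxn 0 lam.
  by have := nth_le_foldr_maxn lam c.-1; rewrite -/(lamc lam c); lia.
have P : (Ordinal cL', Ordinal rH).2 < nth 0 lam (Ordinal cL', Ordinal rH).1.
  by rewrite /= -/(lamc lam c); lia.
exists (exist _ (Ordinal cL', Ordinal rH) P).
by rewrite /rowc /colc /=; lia.
Qed.

Lemma pick_cell u :
  [pick w : cell lam | (rowc w == rowc u) && (colc w == colc u)] = Some u.
Proof.
case: pickP => [w /andP[/eqP er /eqP ec]|/(_ u)]; last by rewrite !eqxx.
by rewrite (cell_inj er ec).
Qed.

Lemma fillE s u : fill s (rowc u) (colc u) = (s u).+1.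
Proof. by rewrite /fill pick_cell. Qed.

Lemma valid_fill s : valid lam n (fill s).
Proof.
move=> r c; case: (boolP (in_dg lam r c)) => [/cell_exists [u [<- <-]]|out].
  by rewrite fillE ltn_ord.
rewrite /fill; case: pickP => // w /andP[/eqP er /eqP ec].
by move: out; rewrite -er -ec cell_in_dg.
Qed.

(** The tableau [s] supplies the default value in 'I_n that [insubd] requires; likewise the cell [u]
    in [mkcell] below. *)
Definition unfill s (f : rawfill) : Tab lam n :=
  [ffun u => insubd (s u) (f (rowc u) (colc u)).-1].

Lemma unfillK s f : valid lam n f -> fill (unfill s f) =2 f.
Proof.
move=> vf r c; case: (boolP (in_dg lam r c)) => [|out]; last first.
  by rewrite (valid_out (valid_fill _) out) (valid_out vf out).
move=> dg; have := valid_in vf dg; case/cell_exists: dg => u [<- <-] fr.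
by rewrite fillE ffunE val_insubd; case: ifP; lia.
Qed.

Lemma fill_inj s s' : fill s =2 fill s' -> s = s'.
Proof.
move=> E; apply/ffunP => u; apply: val_inj.
by have := E (rowc u) (colc u); rewrite !fillE => -[].
Qed.

Definition mkcell u r c : cell lam :=
  odflt u [pick w | (rowc w == r) && (colc w == c)].

Lemma mkcellP u r c : in_dg lam r c ->
  rowc (mkcell u r c) = r /\ colc (mkcell u r c) = c.
Proof. by case/cell_exists => w [<- <-]; rewrite /mkcell pick_cell. Qed.

Lemma big_cell (T : Type) (idx : T) (op : Monoid.com_law idx) (F : nat -> nat -> T) :
  \big[op/idx]_(u : cell lam) F (rowc u) (colc u) =
  \big[op/idx]_(1 <= c < L.+1) \big[op/idx]_(1 <= r < (hgt c).+1) F r c.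
Proof.
transitivity (\big[op/idx]_(p : 'I_L * 'I_(foldr maxn 0 lam) | p.2 < nth 0 lam p.1)
    F p.2.+1 p.1.+1).
  rewrite (reindex_omap (val : cell lam -> _) insub) => [|p Pp]; last first.
    by rewrite insubT.
  apply: eq_bigl => u.
  by rewrite valK eqxx andbT; apply/esym; exact: (valP u).
rewrite -(pair_big_dep xpredT (fun (i : 'I_L) (j : 'I_(foldr maxn 0 lam)) => j < nth 0 lam i)
  (fun i j => F j.+1 i.+1)) /=.
rewrite big_add1 /= big_mkord; apply: eq_bigr => i _.
rewrite big_add1 /= /lamc /= big_mkord.
by rewrite (big_ord_narrow (nth_le_foldr_maxn lam i)).
Qed.

Lemma dgprodE (R : comNzRingType) (x : nat -> R) s :
  (\prod_(u : cell lam) x (s u).+1)%R = dgprod lam *%R x (fill s).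
Proof.
rewrite /dgprod -big_cell; apply: eq_bigr => u _; by rewrite fillE.
Qed.

Hypothesis lam_sorted : sorted geq lam.

(** Heights decrease, so the rows common to columns c < c' are those of c', the range over which
    [colq] sums. *)
Lemma quinvE s : quinv s = quinvr lam (fill s).
Proof.
set f := fill s.
pose A r c c' : nat := inQ (f r.+1 c) (f r c) (f r c').
transitivity (\sum_(u : cell lam) \sum_(1 <= c' < L.+1) \sum_(1 <= r' < (hgt c').+1)
   (if (rowc u == r') && (colc u < c') then A r' (colc u) c' else 0)).
  apply: eq_bigr => u _; rewrite big_mkcond /=.
  rewrite -(big_cell addn (fun r' c' =>
     if (rowc u == r') && (colc u < c') then A r' (colc u) c' else 0)).
  by apply: eq_bigr => v _; case: eqP => //= ->.
rewrite (big_cell addn (fun r c => \sum_(1 <= c' < L.+1) \sum_(1 <= r' < (hgt c').+1)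
   (if (r == r') && (c < c') then A r' c c' else 0))).
apply: eq_big_nat => c /andP[c0 cL]; rewrite exchange_big /=.
rewrite (@big_cat_nat _ _ _ c.+1) //=.
rewrite [X in X + _]big_nat [X in X + _]big1 ?add0n; last first.
  move=> c' hc'; rewrite big1 // => r _; rewrite big1 // => r' _.
  by have -> : (c < c') = false; [lia | rewrite andbF].
apply: eq_big_nat => c' hc'.
have hh : hgt c' <= hgt c by apply: (lamc_mono lam_sorted); lia.
rewrite exchange_big /=; apply: eq_big_nat => r' hr'.
have -> : c < c' by lia.
rewrite (@bigD1_seq _ _ _ _ _ r') ?iota_uniq ?mem_index_iota //=; last by lia.
by rewrite eqxx /= big1 ?addn0 // => r /negbTE->.
Qed.

(** Membership in the diagram is implicit in [armc]: the entry compared with is positive, whereas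
    entries outside are 0. *)
Lemma downE s u : down s u = armc lam (fill s) (fill s (rowc u) (colc u)) (rowc u) (colc u).
Proof.
set f := fill s; set r := rowc u; set c := colc u.
have dgu := cell_in_dg u; rewrite -/r -/c in dgu.
have [c0 [r0 rc]] : 0 < c /\ 0 < r /\ r <= hgt c by move: dgu; rewrite /in_dg; lia.
have cL := hgt_pos_size (leq_trans r0 rc).
have fa : 0 < f r c by have := valid_in (valid_fill s) dgu; case/andP.
transitivity (\sum_(1 <= c' < L.+1) \sum_(1 <= r' < (hgt c').+1)
   ((((r' == r) && (c' < c)) || ((r' == r.-1) && (c < c'))) && (f r' c' == f r c) : nat)).
  rewrite /down -sum1_card big_mkcond /=.
  rewrite -(big_cell addn (fun r' c' =>
    ((((r' == r) && (c' < c)) || ((r' == r.-1) && (c < c'))) && (f r' c' == f r c) : nat))).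
  apply: eq_bigr => y _; rewrite inE /f /r /c !fillE eqSS -val_eqE.
  by case: (_ && _).
have dlt k c' : 0 < c' -> \sum_(1 <= r' < (hgt c').+1) ((r' == k) && (f k c' == f r c) : nat) = (f k c' == f r c).
  move=> c'0; rewrite sum_nat_delta; case: (boolP (0 < k <= hgt c')) => // kc.
  rewrite (@valid_out lam n f k c' (valid_fill s)); last by rewrite /in_dg; lia.
  by case: eqP => //; lia.
rewrite (@big_cat_nat _ _ _ c) //=; last by lia.
rewrite [X in _ + X]big_ltn // [X in _ + (X + _)]big1 ?add0n => [|r' _]; last first.
  by rewrite !ltnn !andbF.
congr (_ + _); apply: eq_big_nat => c' hc'; rewrite -(dlt _ c'); try lia.
- apply: eq_big_nat => r' _; have -> : c < c' = false by lia.
  by have -> : c' < c by [lia]; rewrite andbT andbF orbF; case: eqP => [->|].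
- apply: eq_big_nat => r' _; have -> : c' < c = false by lia.
  by have -> : c < c' by [lia]; rewrite andbT andbF /=; case: eqP => [->|].
Qed.

(** * The jump map on pairs of a tableau and a cell, and the balance of flows *)

Section Chain.
Variables (R : realFieldType) (x : nat -> R) (t : R).
Hypothesis n_gt0 : 0 < n.
Hypothesis x_gt0 : forall i : nat, 0 < i <= n -> (0 < x i)%R.
Hypothesis t_ge0 : (0 <= t)%R.

Definition south := [set p : Tab lam n * cell lam |
  south_ok (fill p.1) (rowc p.2) (colc p.2)].

Definition north := [set p : Tab lam n * cell lam |
  fill p.1 (rowc p.2).+1 (colc p.2) != fill p.1 (rowc p.2) (colc p.2)].

Definition jump (p : Tab lam n * cell lam) : Tab lam n * cell lam :=
  let r := rowc p.2 in let c := colc p.2 in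
  (unfill p.1 (Rprime lam n (fill p.1) r c),
   mkcell p.2 (ringh lam n (fill p.1) r c) (tcol lam n (fill p.1) r c)).

Definition up s u := armc lam (fill s) (fill s (rowc u) (colc u)) (rowc u).+1 (colc u).

Lemma jump_spec p : p \in south ->
  [/\ fill (jump p).1 =2 Rprime lam n (fill p.1) (rowc p.2) (colc p.2),
      rowc (jump p).2 = ringh lam n (fill p.1) (rowc p.2) (colc p.2) &
      colc (jump p).2 = tcol lam n (fill p.1) (rowc p.2) (colc p.2)].
Proof.
rewrite inE => sok.
have [vg dgw _ _ _] := Rprime_spec lam_sorted n_gt0 (valid_fill p.1) (cell_in_dg p.2) sok.
by have [e1 e2] := mkcellP p.2 dgw; split=> //; apply: unfillK.
Qed.

Lemma jump_inj : {in south &, injective jump}.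
Proof.
move=> p q ps qs E.
have [p1 p2 p3] := jump_spec ps; have [q1 q2 q3] := jump_spec qs.
move: ps qs; rewrite !inE => ps qs.
case: (Rprime_inj lam_sorted n_gt0 (valid_fill p.1) (valid_fill q.1)
  (cell_in_dg p.2) (cell_in_dg q.2) ps qs).
- by move=> i j; rewrite -p1 -q1 E.
- by rewrite -p2 -q2 E.
- by rewrite -p3 -q3 E.
move=> /fill_inj e1 e2 e3.
by rewrite [p]surjective_pairing [q]surjective_pairing e1 (cell_inj e2 e3).
Qed.

Lemma jump_north p : p \in south -> jump p \in north.
Proof.
move=> ps; have [p1 p2 p3] := jump_spec ps; move: ps; rewrite !inE => ps.
have [_ _ _ ne _] := Rprime_spec lam_sorted n_gt0 (valid_fill p.1) (cell_in_dg p.2) ps.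
by rewrite !p1 p2 p3; apply/eqP.
Qed.

Local Open Scope ring_scope.

(** The ring is arbitrary because two instances are needed: all weights 1 over the integers, to
    count [south] and [north], and the actual rates. *)
Lemma out_rate_eq (S : comNzRingType) (y : nat -> S) (z : S) s :
  \sum_(u : cell lam) (if south_ok (fill s) (rowc u) (colc u)
      then y (s u).+1 * z ^+ down s u else 0) =
  \sum_(u : cell lam) (if fill s (rowc u).+1 (colc u) != fill s (rowc u) (colc u)
      then y (s u).+1 * z ^+ up s u else 0).
Proof.
under eq_bigr do rewrite downE -fillE.
under [RHS]eq_bigr do rewrite /up -fillE.
have mono := lamc_mono lam_sorted.
have := birth_death z mono (valid_fill s) y.
by rewrite -!big_cell.
Qed.

Lemma card_south_north : #|south| = #|north|.
Proof.
apply/eqP; rewrite -(eqr_nat int) -!sum1_card !natr_sum.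
rewrite [X in X == _]big_mkcond [X in _ == X]big_mkcond /=.
rewrite !sum_pairE; apply/eqP; apply: eq_bigr => s _.
have /(_ s) E := out_rate_eq (fun=> 1 : int) 1.
transitivity (\sum_(u : cell lam) (if south_ok (fill s) (rowc u) (colc u)
    then 1 * 1 ^+ down s u else 0 : int)).
  by apply: eq_bigr => u _; rewrite inE expr1n mulr1.
by rewrite E; apply: eq_bigr => u _; rewrite inE expr1n mulr1.
Qed.

Lemma jump_image : jump @: south = north.
Proof.
apply/eqP; rewrite eqEcard card_in_imset; last exact: jump_inj.
rewrite card_south_north leqnn andbT.
by apply/subsetP => q /imsetP[p ps ->]; apply: jump_north.
Qed.

Lemma x_neq0 s u : x (s u).+1 != 0.
Proof. by rewrite gt_eqF // x_gt0 //= ltn_ord. Qed.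

(** The exponents of t agree by the [quinvr] identity of [Rprime_spec], and the monomials in x, each
    divided by the variable of its cell, by [dgprod_Rprime]. *)
Lemma flow_jump p : p \in south ->
  wt x t p.1 * ((x (p.1 p.2).+1)^-1 * t ^+ down p.1 p.2) =
  wt x t (jump p).1 * ((x ((jump p).1 (jump p).2).+1)^-1 * t ^+ up (jump p).1 (jump p).2).
Proof.
move=> ps; have [p1 p2 p3] := jump_spec ps; move: ps; rewrite !inE => sok.
have [_ _ _ _ Q] := Rprime_spec lam_sorted n_gt0 (valid_fill p.1) (cell_in_dg p.2) sok.
have P := dgprod_Rprime lam_sorted n_gt0 (valid_fill p.1) (cell_in_dg p.2) sok *%R x.
have E : dgprod lam *%R x (fill (jump p).1) =
    dgprod lam *%R x (Rprime lam n (fill p.1) (rowc p.2) (colc p.2)).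
  by apply: eq_bigr => c _; apply: eq_bigr => r _; rewrite p1.
have QE := quinvr_ext lam p1.
have UE := armc_ext lam _ _ _ p1.
rewrite /wt !dgprodE !quinvE downE /up -!fillE.
move: (x_neq0 p.1 p.2) (x_neq0 (jump p).1 (jump p).2); rewrite -!fillE => x1 x2.
move: P Q; rewrite -E -QE -UE -p1 -p2 -p3 /= => P Q.
rewrite !(mulrC _^-1) mulrACA [RHS]mulrACA -!exprD.
suff -> : dgprod lam *%R x (fill p.1) / x (fill p.1 (rowc p.2) (colc p.2)) =
  dgprod lam *%R x (fill (jump p).1) / x (fill (jump p).1 (rowc (jump p).2) (colc (jump p).2)).
  by rewrite Q.
by apply/eqP; rewrite eqr_div // -P.
Qed.

Lemma rateE s s' : rate x t s s' =
  \sum_(u | (s, u) \in south) (if (jump (s, u)).1 == s'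
     then (x (s u).+1)^-1 * t ^+ down s u else 0).
Proof.
rewrite /rate -big_mkcondr; apply: eq_bigl => u; rewrite inE /=.
case: (boolP (south_ok _ _ _)) => //= sok.
have ps : (s, u) \in south by rewrite inE.
have [p1 _ _] := jump_spec ps.
apply/forallP/eqP => [H|<- w]; last by rewrite -fillE p1.
by apply/ffunP => w; apply: val_inj; apply/eqP; rewrite -eqSS -fillE p1 H.
Qed.

Lemma sum_rate s : \sum_s' rate x t s s' =
  \sum_(u | (s, u) \in south) (x (s u).+1)^-1 * t ^+ down s u.
Proof.
under eq_bigr do rewrite rateE.
rewrite exchange_big /=; apply: eq_bigr => u _.
by rewrite (bigD1 (jump (s, u)).1) //= eqxx big1 ?addr0 // => s' /negbTE;
  rewrite eq_sym => ->.
Qed.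

Lemma global_balance s :
  \sum_s' wt x t s' * rate x t s' s = wt x t s * \sum_s' rate x t s s'.
Proof.
pose G (q : Tab lam n * cell lam) : R :=
  wt x t q.1 * ((x (q.1 q.2).+1)^-1 * t ^+ up q.1 q.2).
(* The inflow into s is regrouped by the pairs that jump to s, each flow being measured at its
   arrival. *)
transitivity (\sum_(p in south) (if (jump p).1 == s then G (jump p) else 0)).
  rewrite [RHS]big_mkcond /=.
  rewrite [RHS]sum_pairE.
  apply: eq_bigr => s' _; rewrite rateE big_distrr /= big_mkcond /=.
  apply: eq_bigr => u _; case: ifP => // ps; case: ifP => _; last by rewrite mulr0.
  by rewrite /G -(flow_jump ps).
(* Since [jump] maps [south] onto [north] injectively, this becomes a sum over the cells of s that
   differ from their northern neighbour. *)
rewrite -(big_imset (fun q => if q.1 == s then G q else 0) jump_inj) /= jump_image.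
rewrite big_mkcond sum_pairE /=.
rewrite (bigD1 s) //= [X in _ + X]big1 ?addr0; last first.
  by move=> s' /negbTE ne; apply: big1 => u _; rewrite ne; case: ifP.
rewrite sum_rate [X in _ = _ * X]big_mkcond /=.
under [X in _ * X]eq_bigr do rewrite inE /=.
(* The outflow is brought from southern to northern cells to meet it. *)
rewrite (out_rate_eq (fun i => (x i)^-1)) big_distrr /=.
apply: eq_bigr => u _; rewrite inE eqxx /=.
by case: ifP; rewrite ?mulr0.
Qed.

Lemma wt_ge0 s : 0 <= wt x t s.
Proof.
rewrite mulr_ge0 ?exprn_ge0 // prodr_ge0 // => u _.
by rewrite ltW // x_gt0 //= ltn_ord.
Qed.

(** A constant filling has [quinv] equal to 0, so its weight is positive even when t = 0. *)
Lemma partition_function_gt0 : 0 < \sum_(s : Tab lam n) wt x t s.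
Proof.
pose s0 : Tab lam n := [ffun=> Ordinal n_gt0].
rewrite (bigD1 s0) //= ltr_pwDl // ?sumr_ge0 // => [|s _]; last exact: wt_ge0.
rewrite /wt [quinv s0](_ : _ = 0%N) ?expr0 ?mul1r.
  by rewrite prodr_gt0 // => u _; rewrite x_gt0 //= ltn_ord.
rewrite /quinv big1 // => u _; rewrite big1 // => v _.
by rewrite !fillE !ffunE inQ_diag.
Qed.

End Chain.
End Tableaux.

Local Open Scope ring_scope.

Theorem theorem4p6 (R : realFieldType) (lam : seq nat) (n : nat)
    (x : nat -> R) (t : R) :
  is_partition lam -> (0 < n)%N ->
  (forall i : nat, (0 < i <= n)%N -> 0 < x i) -> 0 <= t ->
  let Z := \sum_(s : Tab lam n) wt x t s in
  0 < Z /\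
  is_stationary (fun s : Tab lam n => wt x t s / Z) (rate x t).
Proof.
move=> /andP[lam_sorted _] n_gt0 x_gt0 t_ge0 Z; split.
  exact: partition_function_gt0.
move=> s; rewrite mulrAC -global_balance // mulr_suml.
by apply: eq_bigr => s' _; rewrite mulrAC.
Qed.
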